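(* Let $\mathcal{A}$ be a central arrangement of hyperplanes in $\mathbb{C}^\ell$. Then, for all $i\ge 1$, $$b'_{i,i+1}\ \ge\ i\sum_{X\in L_2(\mathcal{A})}\binom{\mu(X)+i-1}{i+1}.$$ Moreover, if equality holds for $i=2$, then it holds for all $i\ge 2$.
   Context: $\Bbbk$ is a field of characteristic $0$. For a finite central arrangement $\mathcal{A}=\{H_1,\dots,H_n\}$ of hyperplanes in $\mathbb{C}^\ell$, let $E$ be the exterior algebra over $\Bbbk$ on degree-one generators $e_1,\dots,e_n$, with derivation $\partial$ given by $\partial(e_i)=1$ and the graded Leibniz rule, and $e_J=e_{i_1}\wedge\cdots\wedge e_{i_r}$ for $J=\{i_1<\dots<i_r\}$. The Orlik-Solomon ideal $I\subset E$ is generated by all $\partial e_J$ with $\operatorname{codim}\bigcap_{i\in J}H_i<|J|$; the Orlik-Solomon algebra is $A=E/I$, graded by degree. The graded Betti numbers are $b'_{ij}=\dim_\Bbbk\operatorname{Tor}_i^E(A,\Bbbk)_j$ ($j$ is the internal degree). $L_2(\mathcal{A})$ is the set of rank (codimension) $2$ elements of the intersection lattice of $\mathcal{A}$ and $\mu$ is the Möbius function of that lattice; for $X\in L_2(\mathcal{A})$, $\mu(X)=|\{H\in\mathcal{A}: H\supset X\}|-1$. *)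

(* Defs.v *)
From HB Require Import structures.
From mathcomp Require Import all_boot all_algebra falgebra.
From mathcomp Require Import reals complex.

Set Implicit Arguments.
Unset Strict Implicit.
Unset Printing Implicit Defensive.

Import GRing.Theory.

Local Open Scope ring_scope.

(* The number of pairs (i, j) in S x T with j < i. *)
Definition inversions n (S T : {set 'I_n}) : nat :=
  (\sum_(i in S) \sum_(j in T) (j < i))%N.

Lemma inversionsUl n (S T V : {set 'I_n}) : S \subset T ->
  inversions T V = (inversions S V + inversions (T :\: S) V)%N.
Proof.
by move=> sST; rewrite /inversions (big_setID S) /= (setIidPr sST).
Qed.

Lemma inversionsUr n (S T V : {set 'I_n}) : S \subset T ->
  inversions V T = (inversions V S + inversions V (T :\: S))%N.
Proof.
move=> sST; rewrite /inversions -big_split; apply: eq_bigr => i _.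
by rewrite (big_setID S) /= (setIidPr sST).
Qed.

(* The exterior algebra on n generators: x : exterior k n is the vector       *)
(* \sum_S x S *: e_S, where e_S is the product of the e_i for i in S taken    *)
(* in increasing order.                                                       *)
Definition exterior (k : fieldType) (n : nat) : Type := {ffun {set 'I_n} -> k^o}.

Section ExteriorAlgebra.
Variables (k : fieldType) (n : nat).
Local Notation E := (exterior k n).

HB.instance Definition _ := Vector.copy E {ffun {set 'I_n} -> k^o}.

Definition ext_basis (S : {set 'I_n}) : E := [ffun T => (T == S)%:R].
Definition ext_mul (x y : E) : E :=
  [ffun U : {set 'I_n} => \sum_(S : {set 'I_n} | S \subset U)
     (-1) ^+ inversions S (U :\: S) * (x S * y (U :\: S))].

Lemma exteriorP (x y : E) : (forall S, x S = y S) -> x = y.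
Proof. by move=> h; apply/ffunP. Qed.

Let addE (x y : E) S : (x + y) S = x S + y S.
Proof. exact: ffunE. Qed.

Let scaleE (a : k) (x : E) S : (a *: x) S = a * x S.
Proof. exact: ffunE. Qed.

Let oppE (x : E) S : (- x) S = - x S.
Proof. exact: ffunE. Qed.

Lemma ext_mulA : associative ext_mul.
Proof.
move=> x y z; apply: exteriorP => U; rewrite !ffunE.
under eq_bigr => S sSU do rewrite ffunE !mulr_sumr.
under [RHS]eq_bigr => V sVU do rewrite ffunE mulr_suml mulr_sumr.
rewrite [RHS](exchange_big_dep (fun S : {set 'I_n} => S \subset U)) /=; last first.
  by move=> V S sVU sSV; apply: subset_trans sVU.
apply: eq_bigr => S sSU.
rewrite [RHS](reindex_onto (fun T : {set 'I_n} => S :|: T) (fun V => V :\: S)) /=; last first.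
  by move=> V /andP[sVU sSV]; rewrite setDE setUIr setUCr setIT; apply/setUidPr.
apply: eq_big => [T|T].
  apply/idP/idP=> [|/andP[/andP[]]].
    rewrite subsetD => /andP[sTU]; rewrite disjoint_sym => dST.
    rewrite subUset sSU sTU subsetUl /= setDUl setDv set0U.
    by apply/eqP/setDidPl; rewrite disjoint_sym.
  rewrite subUset => /andP[_ sTU] _ /eqP eT.
  by rewrite subsetD sTU /= -eT disjoints_subset setDE subsetIr.
rewrite subsetD => /andP[sTU]; rewrite disjoint_sym => dST.
have eT : (S :|: T) :\: S = T.
  by rewrite setDUl setDv set0U; apply/setDidPl; rewrite disjoint_sym.
have sSTU : S :|: T \subset U by rewrite subUset sSU.
have eW : U :\: (S :|: T) = U :\: S :\: T by rewrite setDDl.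
rewrite eT eW.
rewrite (inversionsUl (U :\: S :\: T) (subsetUl S T)) eT.
have sT : T \subset U :\: S by rewrite subsetD sTU disjoint_sym.
rewrite (inversionsUr S sT) !exprD.
rewrite -!mulrA [in RHS](mulrCA _ ((-1) ^+ inversions S T)) [RHS]mulrCA.
by congr (_ * (_ * _)); rewrite mulrCA.
Qed.

Lemma ext_mul1l : left_id (ext_basis set0) ext_mul.
Proof.
move=> x; apply: exteriorP => U; rewrite ffunE (bigD1 set0) ?sub0set //= big1 => [|S].
  by rewrite addr0 ffunE eqxx mul1r setD0 /inversions big_set0 mul1r.
by case/andP=> _ nS; rewrite ffunE (negPf nS) mul0r mulr0.
Qed.

Lemma ext_mul1r : right_id (ext_basis set0) ext_mul.
Proof.
move=> x; apply: exteriorP => U; rewrite ffunE (bigD1 U) //= big1 => [|S].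
  rewrite addr0 ffunE setDv eqxx mulr1 /inversions big1 ?mul1r // => i _.
  by rewrite big_set0.
case/andP=> sSU nS; rewrite ffunE setD_eq0.
have /negPf-> : ~~ (U \subset S) by apply: contraNN nS => sUS; rewrite eqEsubset sSU.
by rewrite !mulr0.
Qed.

Lemma ext_mulDl : left_distributive ext_mul +%R.
Proof.
move=> x y z; apply: exteriorP => U; rewrite addE !ffunE -big_split.
by apply: eq_bigr => S _; rewrite addE mulrDl mulrDr.
Qed.

Lemma ext_mulDr : right_distributive ext_mul +%R.
Proof.
move=> x y z; apply: exteriorP => U; rewrite addE !ffunE -big_split.
by apply: eq_bigr => S _; rewrite addE !mulrDr.
Qed.

Lemma ext_1_neq0 : ext_basis set0 != 0.
Proof.
apply/eqP => /ffunP/(_ set0); rewrite !ffunE eqxx => /eqP.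
by rewrite oner_eq0.
Qed.

HB.instance Definition _ := GRing.Zmodule_isNzRing.Build E
  ext_mulA ext_mul1l ext_mul1r ext_mulDl ext_mulDr ext_1_neq0.

Lemma ext_scalerAl (a : k) (x y : E) : a *: (x * y) = (a *: x) * y.
Proof.
apply: exteriorP => U; rewrite scaleE !ffunE mulr_sumr.
by apply: eq_bigr => S _; rewrite scaleE mulrCA -mulrA.
Qed.

HB.instance Definition _ := GRing.Lmodule_isLalgebra.Build k E ext_scalerAl.

Lemma ext_scalerAr (a : k) (x y : E) : a *: (x * y) = x * (a *: y).
Proof.
apply: exteriorP => U; rewrite scaleE !ffunE mulr_sumr.
by apply: eq_bigr => S _; rewrite scaleE mulrCA; congr (_ * _); rewrite mulrCA.
Qed.

HB.instance Definition _ := GRing.Lalgebra_isAlgebra.Build k E ext_scalerAr.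
HB.instance Definition _ := Algebra_isFalgebra.Build k E.


(* ext_diff is the derivation with e_i |-> 1 for all i, see ext_diff_gen and  *)
(* ext_diff_Leibniz.                                                          *)
Definition ext_gen (i : 'I_n) : E := ext_basis [set i].
Definition ext_diff (x : E) : E :=
  [ffun S : {set 'I_n} => \sum_(i | i \notin S)
     (-1) ^+ #|[set j in S | j < i]%N| * x (i |: S)].
Definition ext_homog (d : nat) (x : E) : bool :=
  [forall S, (x S != 0) ==> (#|S| == d)].

(* The augmentation E -> k with kernel (e_1, ..., e_n). *)
Definition ext_aug (x : E) : k := x set0.

Lemma ext_aug_is_zmod_morphism : zmod_morphism ext_aug.
Proof. by move=> x y; rewrite /ext_aug addE oppE. Qed.

Lemma ext_aug_is_monoid_morphism : monoid_morphism ext_aug.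
Proof.
split=> [|x y]; first by rewrite /ext_aug ffunE eqxx.
rewrite /ext_aug ffunE (bigD1 set0) ?sub0set //= big1 => [|S].
  by rewrite addr0 setD0 /inversions big_set0 mul1r.
by rewrite subset0 andbN.
Qed.

HB.instance Definition _ :=
  GRing.isZmodMorphism.Build E k ext_aug ext_aug_is_zmod_morphism.
HB.instance Definition _ :=
  GRing.isMonoidMorphism.Build E k ext_aug ext_aug_is_monoid_morphism.

Lemma ext_genME i (x : E) (U : {set 'I_n}) :
  (ext_gen i * x) U =
    if i \in U then (-1) ^+ #|[set j in U | j < i]%N| * x (U :\ i) else 0.
Proof.
rewrite ffunE; case: ifPn => iU; last first.
  rewrite big1 // => S sSU; rewrite ffunE; case: eqP => [eS|_].
    by rewrite eS sub1set (negPf iU) in sSU.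
  by rewrite mul0r mulr0.
rewrite (bigD1 [set i]) ?sub1set //= big1 ?addr0 => [|S /andP[_ nS]]; last first.
  by rewrite ffunE (negPf nS) mul0r mulr0.
rewrite ffunE eqxx mul1r; congr (_ ^+ _ * _).
rewrite /inversions big_set1 -sum1_card big_mkcond [RHS]big_mkcond /=.
apply: eq_bigr => j _; rewrite !inE.
by case: eqP => [->|_] /=; rewrite ?ltnn ?andbF //; case: (j \in U); case: ltnP.
Qed.

Lemma ext_gen_sqr i : ext_gen i * ext_gen i = 0.
Proof.
apply: exteriorP => U; rewrite ext_genME !ffunE; case: ifPn => // iU.
case: eqP => [e|_]; last by rewrite mulr0.
by have := setD11 i U; rewrite e set11.
Qed.

Lemma ext_gen_anticomm i j : i != j ->
  ext_gen i * ext_gen j = - (ext_gen j * ext_gen i).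
Proof.
have Hlt (a b : 'I_n) : (a < b)%N -> ext_gen a * ext_gen b = ext_basis [set a; b].
  move=> ltab; apply: exteriorP => U; rewrite ext_genME !ffunE.
  have nab : b != a by rewrite -val_eqE /= neq_ltn ltab orbT.
  case: ifPn => aU; last by case: eqP aU => // ->; rewrite set21.
  have -> : (U :\ a == [set b]) = (U == [set a; b]).
    apply/eqP/eqP => [e|->]; first by rewrite -(setD1K aU) e.
    by apply/setP=> c; rewrite !inE; case: eqP => [->|] //=; rewrite eq_sym (negPf nab).
  case: eqP => [->|_]; last by rewrite mulr0.
  rewrite (_ : [set c in _ | _] = set0) ?cards0 ?mul1r //.
  apply/setP=> c; rewrite !inE; apply/negP => /andP[/orP[]/eqP->].
    by rewrite ltnn.
  by rewrite ltnNge ltnW.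
have Hgt (a b : 'I_n) : (a < b)%N -> ext_gen b * ext_gen a = - ext_basis [set a; b].
  move=> ltab; apply: exteriorP => U; rewrite ext_genME !ffunE.
  have nab : b != a by rewrite -val_eqE /= neq_ltn ltab orbT.
  case: ifPn => bU; last by case: eqP bU => [->|]; rewrite ?set22 // oppr0.
  have -> : (U :\ b == [set a]) = (U == [set a; b]).
    apply/eqP/eqP => [e|->]; first by rewrite -(setD1K bU) e setUC.
    by apply/setP=> c; rewrite !inE orbC; case: eqP => [->|] //=; rewrite (negPf nab).
  case: eqP => [->|_]; last by rewrite mulr0 oppr0.
  rewrite (_ : [set c in _ | _] = [set a]) ?cards1 ?mulr1 //.
  apply/setP=> c; rewrite !inE; case: eqP => [->|_] //=.
  by case: eqP => [->|]; rewrite ?ltnn.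
rewrite -val_eqE /= neq_ltn => /orP[] lt; first by rewrite Hlt // Hgt // opprK.
by rewrite Hgt // Hlt // setUC.
Qed.

Lemma ext_basisE (S : {set 'I_n}) : ext_basis S = \prod_(i <- enum S) ext_gen i.
Proof.
have sE : sorted (fun i j : 'I_n => i < j)%N (enum S).
  rewrite /enum_mem; apply: sorted_filter => [a b c|]; first exact: ltn_trans.
  by rewrite -(@sorted_map _ _ val ltn) -enumT val_enum_ord iota_ltn_sorted.
rewrite -[S in LHS](set_enum S).
elim: (enum S) sE => [|i s IHs] /=; first by rewrite big_nil set_nil.
rewrite big_cons => si; rewrite -IHs ?(path_sorted si) //.
have lt_i j : j \in s -> (i < j)%N.
  move: si; rewrite path_sortedE => [/andP[/allP a _]|a b c]; first exact: a.
  exact: ltn_trans.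
have nis : i \notin s by apply/negP => /lt_i; rewrite ltnn.
apply: exteriorP => U; rewrite ext_genME !ffunE set_cons.
case: ifPn => iU; last by case: eqP iU => // ->; rewrite setU11.
have -> : (U :\ i == [set x in s]) = (U == i |: [set x in s]).
  apply/eqP/eqP => [<-|->]; first by rewrite setD1K.
  by rewrite setU1K // inE.
case: eqP => [->|_]; last by rewrite mulr0.
rewrite (_ : [set j in _ | _] = set0) ?cards0 ?mul1r //.
apply/setP=> j; rewrite !inE; apply/negP => /andP[/orP[/eqP->|/lt_i lt_ij]].
  by rewrite ltnn.
by rewrite ltnNge ltnW.
Qed.

Lemma ext_diff_genM i (x : E) : ext_diff (ext_gen i * x) = x - ext_gen i * ext_diff x.
Proof.
apply: exteriorP => U; rewrite addE oppE ext_genME [LHS]ffunE.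
case: ifPn => iU; last first.
  rewrite oppr0 addr0 (bigD1 i) //= big1 ?addr0 => [|a /andP[_ nai]]; last first.
    by rewrite ext_genME !inE eq_sym (negPf nai) (negPf iU) mulr0.
  rewrite ext_genME setU11 mulrA -exprD setU1K // (_ : [set j in i |: U | _] = [set j in U | (j < i)%N]).
    by rewrite addnn -muln2 mulnC exprM sqrrN expr1n expr1n mul1r.
  by apply/setP=> j; rewrite !inE; case: eqP => [->|] //=; rewrite ltnn andbF.
rewrite ffunE [in RHS](bigD1 i) ?setD11 //= setD1K // mulrDr opprD addrA.
have -> : [set j in U :\ i | (j < i)%N] = [set j in U | (j < i)%N].
  by apply/setP=> j; rewrite !inE; case: eqP => [->|] //=; rewrite ltnn andbF.
rewrite mulrA -exprD addnn -muln2 mulnC exprM sqrrN !expr1n mul1r subrr add0r.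
rewrite mulr_sumr -sumrN; apply: eq_big => [a|a naU].
  by rewrite !inE negb_and negbK; case: eqP => [->|]; rewrite ?iU //= andbT.
have nai : a != i by apply: contraNneq naU => ->.
rewrite ext_genME !inE iU orbT !mulrA -!exprD -mulNr.
have -> : (a |: U) :\ i = a |: U :\ i.
  by apply/setP=> c; rewrite !inE; case: eqP => [->|] //=; rewrite eq_sym (negPf nai).
congr (_ * _); rewrite -[RHS]mulN1r -exprS -[LHS]signr_odd -[RHS]signr_odd.
congr (_ ^+ (nat_of_bool _)); rewrite /= !oddD.
have cD (p : pred 'I_n) : #|[set j in U | p j]| = (p i + #|[set j in U :\ i | p j]|)%N.
  rewrite (cardsD1 i) inE iU; congr (_ + #|pred_of_set _|)%N.
  by apply/setP=> j; rewrite !inE andbA.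
have cU (p : pred 'I_n) : #|[set j in a |: U | p j]| = (p a + #|[set j in U | p j]|)%N.
  rewrite (cardsD1 a) !inE eqxx; congr (_ + #|pred_of_set _|)%N.
  apply/setP=> j; rewrite !inE; case: eqP => [->|] //=.
  by rewrite (negPf naU).
rewrite (cU (fun j => j < i)%N) (cD (fun j => j < a)%N) !oddD !oddb.
have : (a < i)%N = ~~ (i < a)%N.
  by rewrite -leqNgt [RHS]leq_eqVlt (negPf (nai : (a : nat) != i)).
by move->; case: (i < a)%N; do 2!case: odd.
Qed.

Lemma ext_diff1 : ext_diff 1 = 0.
Proof.
apply: exteriorP => S; rewrite !ffunE big1 // => i _; rewrite ffunE.
by case: eqP => [e|_]; rewrite ?mulr0 //; have := setU11 i S; rewrite e inE.
Qed.

Lemma ext_diff_gen i : ext_diff (ext_gen i) = 1.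
Proof. by rewrite -[ext_gen i]mulr1 ext_diff_genM ext_diff1 mulr0 subr0. Qed.

Lemma ext_diff_Leibniz (s : seq 'I_n) (y : E) (x := \prod_(i <- s) ext_gen i) :
  ext_diff (x * y) = ext_diff x * y + (-1) ^+ size s *: (x * ext_diff y).
Proof.
rewrite {}/x; elim: s => [|i s IHs] /=.
  by rewrite big_nil !mul1r ext_diff1 mul0r add0r scale1r.
rewrite big_cons -mulrA !ext_diff_genM IHs mulrBl mulrDr opprD addrA !mulrA.
by rewrite exprS mulN1r scaleNr -scalerAr !mulrA.
Qed.

End ExteriorAlgebra.

Section Arrangement.
Variables (K : fieldType) (l n : nat).
Local Notation V := 'rV[K]_l.
Implicit Types (H : 'I_n -> {vspace V}) (X Y Z : {vspace V}) (J : {set 'I_n}).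

Definition codim X : nat := (l - \dim X)%N.

Definition central_arrangement H : Prop :=
  injective H /\ forall i, codim (H i) = 1%N.

Lemma dim_fullv : \dim (fullv : {vspace V}) = l.
Proof. by rewrite dimvf /dim /= mul1n. Qed.

Definition flat H J : {vspace V} := (\bigcap_(i in J) H i)%VS.

Definition intersection_lattice H : seq {vspace V} :=
  undup [seq flat H J | J <- enum {: {set 'I_n}}].

Definition rank2_flats H : seq {vspace V} :=
  [seq X <- intersection_lattice H | codim X == 2].

(* mu(X) = - \sum_(Y < X) mu(Y), where Y < X in the intersection lattice, i.e.*)
(* Y strictly contains X. The recursion is on a bound for the codimension.    *)
Fixpoint mobius_rec H (d : nat) X : int :=
  if X == fullv then 1 else
  if d is d'.+1 then
    - \sum_(Y <- intersection_lattice H | (X <= Y)%VS && (Y != X)) mobius_rec H d' Y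
  else 0.
Definition mobius H X : int := mobius_rec H (codim X) X.

Lemma mobiusE H X : X \in intersection_lattice H ->
  \sum_(Y <- intersection_lattice H | (X <= Y)%VS) mobius H Y = (X == fullv)%:R.
Proof.
have codim0 Y : codim Y = 0%N -> Y = fullv.
  move/eqP; rewrite subn_eq0 => leY; apply/eqP; rewrite eqEdim subvf /=.
  by rewrite dim_fullv.
have recE d Y : (codim Y <= d)%N -> mobius_rec H d Y = mobius H Y.
  rewrite /mobius; have [m] := ubnP d; elim: m d Y => // m IHm [|d] Y ltdm.
    by rewrite leqn0 => /eqP->.
  case eY: (codim Y) => [|c] /=; first by rewrite (codim0 _ eY) eqxx.
  move=> lecd; case: ifP => // _; congr (- _); apply: eq_bigr => Z /andP[sYZ nZY].
  have ltZ : (codim Z <= c)%N.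
    rewrite -ltnS -eY /codim ltn_sub2l //.
      by rewrite -subn_gt0 -/(codim Y) eY.
    by rewrite ltnNge; apply: contra nZY => le; rewrite eq_sym eqEdim sYZ.
  rewrite (IHm d) // ?(leq_trans ltZ) // (IHm c) //.
  exact: leq_ltn_trans lecd ltdm.
have UL : uniq (intersection_lattice H) by exact: undup_uniq.
move=> XL; rewrite -big_filter (bigD1_seq X) ?mem_filter ?subvv ?filter_uniq //=.
rewrite big_filter_cond /=; have [->|nX] := eqVneq X fullv.
  rewrite {1}/mobius big1 ?addr0; first by case: codim => [|d] /=; rewrite eqxx.
  by move=> Y /andP[sY]; rewrite eqEsubv sY subvf.
rewrite {1}/mobius; case eX: (codim X) => [|d] /=.
  by rewrite (codim0 _ eX) eqxx in nX.
rewrite (negPf nX) addrC; apply/eqP; rewrite subr_eq0; apply/eqP.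
apply: eq_bigr => Y /andP[sXY nYX]; rewrite recE // -ltnS -eX.
rewrite /codim ltn_sub2l //; first by rewrite -subn_gt0 -/(codim X) eX.
by rewrite ltnNge; apply: contra nYX => le; rewrite eq_sym eqEdim sXY.
Qed.

Lemma flat_codim0 X : codim X = 0%N -> X = fullv.
Proof.
move/eqP; rewrite subn_eq0 => leX; apply/eqP; rewrite eqEdim subvf /=.
by rewrite dim_fullv.
Qed.

Lemma codim_inj X Y : (X <= Y)%VS -> codim X = codim Y -> X = Y.
Proof.
move=> sXY eXY; apply/eqP; rewrite eqEdim sXY /=.
have le Z : (\dim Z <= l)%N by apply: leq_trans (dimvS (subvf Z)) _; rewrite dim_fullv.
by rewrite -(subKn (le Y)) -(subKn (le X)) -/(codim X) eXY.
Qed.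

Lemma codimS X Y : (X <= Y)%VS -> (codim Y <= codim X)%N.
Proof. by move=> sXY; apply/leq_sub2l/dimvS. Qed.

Lemma flat_in H J : flat H J \in intersection_lattice H.
Proof. by rewrite mem_undup; apply: map_f; rewrite mem_enum. Qed.

Lemma mobiusT H : mobius H fullv = 1.
Proof. by rewrite /mobius; case: codim => [|d] /=; rewrite eqxx. Qed.

Lemma rank_le1P H Y : central_arrangement H -> Y \in intersection_lattice H ->
  (codim Y <= 1)%N -> Y = fullv \/ exists i, Y = H i.
Proof.
move=> [_ cH]; rewrite mem_undup => /mapP[J _ ->].
have [->|[i iJ]] := set_0Vmem J; first by left; rewrite /flat big_set0.
move=> le1; have sJ : (flat H J <= H i)%VS by rewrite /flat (bigD1 i) //= capvSl.
right; exists i; apply: codim_inj => //; apply/eqP.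
by rewrite eqn_leq cH le1 -(cH i) codimS.
Qed.

Lemma hyperplane_in H i : H i \in intersection_lattice H.
Proof. by have := flat_in H [set i]; rewrite /flat big_set1. Qed.

Lemma fullv_in H : fullv \in intersection_lattice H.
Proof. by have := flat_in H set0; rewrite /flat big_set0. Qed.

Lemma hyperplane_proper H i : central_arrangement H -> H i != fullv.
Proof.
move=> [_ cH]; apply/eqP => e; have := cH i.
by rewrite e /codim dim_fullv subnn.
Qed.

Lemma hyperplane_mobius H i : central_arrangement H -> mobius H (H i) = -1.
Proof.
move=> AH; have nHf := hyperplane_proper i AH.
have /eqP := mobiusE (hyperplane_in H i).
rewrite -big_filter (perm_big [:: H i; fullv]) /=.
  by rewrite !big_cons big_nil addr0 mobiusT (negPf nHf) addr_eq0 => /eqP.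
apply: uniq_perm; rewrite ?filter_uniq ?undup_uniq //= ?inE ?nHf // => Y.
rewrite mem_filter !inE; apply/andP/orP => [[sY YL]|[]/eqP->].
- have /(rank_le1P AH YL)[->|[j eY]] : (codim Y <= 1)%N.
    by rewrite -(AH.2 i) codimS.
  + by right.
  + by left; apply/eqP; rewrite [RHS](codim_inj sY) // eY !AH.2.
- by rewrite subvv hyperplane_in.
- by rewrite subvf fullv_in.
Qed.

Lemma rank2_mobius H X : central_arrangement H -> X \in rank2_flats H ->
  mobius H X = #|[set i | (X <= H i)%VS]|%:Z - 1.
Proof.
move=> AH; rewrite mem_filter => /andP[/eqP cX XL].
have nXf : X != fullv.
  by apply/eqP => e; move: cX; rewrite e /codim dim_fullv subnn.
have nXH i : X != H i by apply/eqP => e; move: cX; rewrite e AH.2.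
set B := [set i | _]; have /eqP := mobiusE XL.
rewrite -big_filter (perm_big (X :: fullv :: [seq H i | i <- enum B])) /=.
  rewrite !big_cons mobiusT (negPf nXf) big_map.
  under eq_bigr do rewrite hyperplane_mobius //.
  rewrite big_const_seq count_predT -cardE iter_addr_0 addr_eq0 => /eqP->.
  by rewrite mulNrn opprD opprK addrC natz.
have nfm : fullv \notin [seq H i | i <- enum B].
  by apply/mapP => -[i _ e]; have := hyperplane_proper i AH; rewrite -e eqxx.
have nXm : X \notin [seq H i | i <- enum B].
  by apply/mapP => -[i _ e]; have := nXH i; rewrite -e eqxx.
apply: uniq_perm; rewrite ?filter_uniq ?undup_uniq //=.
  by rewrite inE negb_or nXf nXm nfm map_inj_uniq ?enum_uniq //; case: AH.
move=> Y; rewrite mem_filter !inE; apply/andP/or3P => [[sY YL]|[/eqP->|/eqP->|]].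
- have [lt1|] := leqP (codim Y) 1.
    have [->|[i eY]] := rank_le1P AH YL lt1; first by constructor 2.
    by constructor 3; rewrite eY map_f // mem_enum inE -eY.
  move=> le2; constructor 1; apply/eqP/esym/codim_inj => //.
  by apply/eqP; rewrite eqn_leq {1}cX le2 codimS.
- by [].
- by rewrite subvf fullv_in.
- by case/mapP=> i; rewrite mem_enum inE => sX ->; rewrite sX hyperplane_in.
Qed.
End Arrangement.

Section OrlikSolomon.
Variables (k K : fieldType) (l n : nat) (H : 'I_n -> {vspace 'rV[K]_l}).
Local Notation E := (exterior k n).

Definition dependent (J : {set 'I_n}) : bool := (codim (flat H J) < #|J|)%N.

Definition os_generators : seq E :=
  [seq ext_diff (ext_basis k J) | J <- enum {: {set 'I_n}} & dependent J].

(* The two-sided ideal spanned by the products x * ext_diff e_J * y.          *)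
Definition os_ideal : {vspace E} := (fullv * <<os_generators>> * fullv)%VS.

Definition orlik_solomon : Type := Quotient.quot os_ideal.
HB.instance Definition _ := GRing.Zmodule.on orlik_solomon.

Definition os_proj (x : E) : orlik_solomon := \pi_(Quotient.quot os_ideal)%qT x.

Lemma os_projP x y : os_proj x = os_proj y <-> x - y \in os_ideal.
Proof.
rewrite (Quotient.idealrBE os_ideal); split; first by move/eqP.
by move/eqP.
Qed.

Lemma os_proj_is_zmod_morphism : zmod_morphism os_proj.
Proof. exact: (raddfB \pi_(Quotient.quot os_ideal)%qT). Qed.

HB.instance Definition _ :=
  GRing.isZmodMorphism.Build E orlik_solomon os_proj os_proj_is_zmod_morphism.

Definition os_repr (u : orlik_solomon) : E :=
  generic_quotient.repr (u : Quotient.quot os_ideal).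

Lemma os_reprK : cancel os_repr os_proj.
Proof. exact: generic_quotient.reprK. Qed.

Lemma os_idealMl a x : x \in os_ideal -> a * x \in os_ideal.
Proof.
move=> xI; have := memv_mul (memvf a) xI; apply: subvP.
by rewrite /os_ideal !prodvA; do 2!apply: prodvSl; exact: subvf.
Qed.

(* The action of E on A = E / I by left multiplication. *)
Definition os_scale (a : E) (u : orlik_solomon) : orlik_solomon :=
  os_proj (a * os_repr u).

Lemma os_scaleE a x : os_scale a (os_proj x) = os_proj (a * x).
Proof. by apply/os_projP; rewrite -mulrBr os_idealMl //; apply/os_projP/os_reprK. Qed.

Lemma os_scaleA a b u : os_scale a (os_scale b u) = os_scale (a * b) u.
Proof. by rewrite -(os_reprK u) !os_scaleE mulrA. Qed.

Lemma os_scale1 : left_id 1 os_scale.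
Proof. by move=> u; rewrite -(os_reprK u) os_scaleE mul1r. Qed.

Lemma os_scaleDr : right_distributive os_scale +%R.
Proof.
move=> a u v; rewrite -(os_reprK u) -(os_reprK v) -raddfD !os_scaleE -raddfD.
by rewrite mulrDr.
Qed.

Lemma os_scaleDl u : {morph os_scale^~ u : a b / a + b}.
Proof. by move=> a b; rewrite -(os_reprK u) !os_scaleE -raddfD mulrDl. Qed.

HB.instance Definition _ := GRing.Zmodule_isLmodule.Build E orlik_solomon
  os_scaleA os_scale1 os_scaleDr os_scaleDl.

Definition os_homog (d : nat) (u : orlik_solomon) : Prop :=
  exists2 x : E, ext_homog d x & u = os_proj x.

End OrlikSolomon.

(* A resolution of a graded left E-module M by free modules of finite rank,   *)
(*   ... -> F_2 -> F_1 -> F_0 -> M -> 0,  F_i = \bigoplus_a E(- res_deg i a), *)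
(* where homog d is the set of homogeneous elements of M of degree d. F_i is  *)
(* the module of row vectors 'rV[E]_(res_rank i), the matrix res_diff i acts  *)
(* on the right as the differential F_(i+1) -> F_i, and res_aug gives the     *)
(* images in M of the basis vectors of F_0.                                   *)
Record graded_free_resolution (k : fieldType) (n : nat)
    (M : lmodType (exterior k n)) (homog : nat -> M -> Prop) := GradedFreeResolution {
  res_rank : nat -> nat;
  res_deg : forall i, 'I_(res_rank i) -> nat;
  res_diff : forall i, 'M[exterior k n]_(res_rank i.+1, res_rank i);
  res_aug : 'I_(res_rank 0) -> M;
  res_diff_homog : forall i (a : 'I_(res_rank i.+1)) (b : 'I_(res_rank i)) S,
    res_diff i a b S != 0 -> res_deg a = (#|S| + res_deg b)%N;
  res_aug_homog : forall a, homog (res_deg a) (res_aug a);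
  res_aug_surj : forall m : M, exists v : 'rV_(res_rank 0),
    m = \sum_a v ord0 a *: res_aug a;
  res_exact0 : forall v : 'rV_(res_rank 0),
    \sum_a v ord0 a *: res_aug a = 0 <-> exists w, v = w *m res_diff 0;
  res_exactS : forall i (v : 'rV_(res_rank i.+1)),
    v *m res_diff i = 0 <-> exists w, v = w *m res_diff i.+1 }.
Arguments res_deg {k n M homog} g {i} a.

Section Tor.
Variables (k : fieldType) (n : nat) (M : lmodType (exterior k n)).
Variables (homog : nat -> M -> Prop) (F : graded_free_resolution homog).

(* k (x)_E F is the complex of the spaces 'rV[k]_(res_rank F i), whose        *)
(* differentials are obtained from those of F by applying E -> k.             *)
Definition tor_diff i : 'M[k]_(res_rank F i.+1, res_rank F i) :=
  map_mx (@ext_aug k n) (res_diff F i).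

(* Its row space is the part of internal degree j of k (x) F_i. *)
Definition tor_degree i j : 'M[k]_(res_rank F i) :=
  diag_mx (\row_a (res_deg F a == j)%:R).

Definition tor_cycles i j : 'M[k]_(res_rank F i) :=
  match i with
  | 0 => tor_degree 0 j
  | i'.+1 => (tor_degree i'.+1 j :&: kermx (tor_diff i'))%MS
  end.

Definition tor_boundaries i j : 'M[k]_(res_rank F i.+1, res_rank F i) :=
  tor_degree i.+1 j *m tor_diff i.

(* The dimension of Tor_i(M, k)_j, where j is the internal degree. As E is     *)
(* graded-commutative, it does not matter that M is taken as a left module.   *)
(* The subtraction is not truncated, by tor_boundaries_sub.                   *)
Definition betti i j : nat := \rank (tor_cycles i j) - \rank (tor_boundaries i j).

Lemma tor_diff_comp i : tor_diff i.+1 *m tor_diff i = 0.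
Proof.
rewrite -map_mxM; suff -> : res_diff F i.+1 *m res_diff F i = 0 by rewrite map_mx0.
apply/row_matrixP => a; rewrite row0 row_mul; apply/res_exactS.
by exists (delta_mx 0 a); rewrite -rowE.
Qed.

Lemma tor_diff_degree i j :
  tor_degree i.+1 j *m tor_diff i = tor_diff i *m tor_degree i j.
Proof.
apply/matrixP => a b; rewrite mul_diag_mx mul_mx_diag !mxE.
have [-> | nz] := eqVneq (ext_aug (res_diff F i a b)) 0; first by rewrite mulr0 mul0r.
by rewrite (res_diff_homog nz) cards0 add0n mulrC.
Qed.

Lemma tor_boundaries_sub i j : (tor_boundaries i j <= tor_cycles i j)%MS.
Proof.
have sub0 : (tor_boundaries i j <= tor_degree i j)%MS.
  by rewrite /tor_boundaries tor_diff_degree submxMl.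
case: i sub0 => [|i] // sub0; rewrite sub_capmx sub0; apply/sub_kermxP.
by rewrite -mulmxA tor_diff_comp mulmx0.
Qed.

End Tor.

(* Main.v *)
(* Let V be the span of the e_i and Gamma the divided power algebra on V.  The
   Cartan complexes F_p (x) Gamma attached to a free resolution F of A are exact, so
   the double complex F (x) Gamma identifies Tor_i(A, k)_(i+1) with the kernel K_i of
   I_2 (x) Gamma_(i-1) -> E_3 (x) Gamma_(i-2).

   As a function w(a, b, s) of indices a, b and of a multiset s, an element of K_i is
   alternating in a, b, satisfies the cyclic identity
   w(a, b, cs) + w(b, c, as) + w(c, a, bs) = 0, and its sum over b in L vanishes for
   every line L (set of hyperplanes through a flat of rank 2) containing a.  Those w
   such that w(a, b, s) = 0 unless s is contained in the line through a and b form the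
   direct sum of the local contributions ker(W_2 (x) Gamma_(i-1) -> W_3 (x) Gamma_(i-2)),
   with W the zero-sum vectors of a line and W_p its p-th exterior power, of dimension
   m = mu(X).  The values w(a, M, s) with a < M, s <= M and all indices distinct from
   a base point are coordinates on the contribution of a line, and their number is
   m 'C(m + i - 1, i) - 'C(m + i, i + 1) = i 'C(m + i - 1, i + 1).

   If the local contributions exhaust K_2 then they exhaust K_i: freezing all entries
   of s but one turns an element of K_i into an element of K_2. *)

Require Import Defs.
From HB Require Import structures.
From mathcomp Require Import all_boot all_order all_algebra falgebra.
From mathcomp Require Import boolp reals complex.
From mathcomp Require Import ring zify.

Set Implicit Arguments.
Unset Strict Implicit.
Unset Printing Implicit Defensive.

Import GRing.Theory.

Local Open Scope ring_scope.

(** * Contractions and the Koszul homotopy *)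

Section Contraction.
Variables (k : fieldType) (n : nat).
Local Notation E := (exterior k n).
Implicit Types (x y : E) (a b : 'I_n) (S U : {set 'I_n}).

Lemma extD x y S : (x + y) S = x S + y S. Proof. exact: ffunE. Qed.
Lemma extN x S : (- x) S = - x S. Proof. exact: ffunE. Qed.
Lemma ext0 S : (0 : E) S = 0. Proof. exact: ffunE. Qed.
Lemma extZ (c : k) x S : (c *: x) S = c * x S. Proof. exact: ffunE. Qed.
Lemma ext_sum I (r : seq I) P (f : I -> E) S :
  (\sum_(i <- r | P i) f i) S = \sum_(i <- r | P i) f i S.
Proof. exact: (big_morph (fun z : E => z S) (fun u v => extD u v S) (ext0 S)). Qed.

(* Locked, as the unifier otherwise unfolds [contract] against
   the pattern [(_ + _) S]. *)
Fact contract_key : unit. Proof. exact: tt. Qed.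
Definition contract a x : E := locked_with contract_key
  [ffun S : {set 'I_n} =>
     if a \in S then 0 else (-1) ^+ #|[set j in S | j < a]%N| * x (a |: S)].

Lemma contractE a x S : contract a x S =
  if a \in S then 0 else (-1) ^+ #|[set j in S | j < a]%N| * x (a |: S).
Proof. by rewrite /contract unlock ffunE. Qed.

Lemma contract_is_linear a : linear (contract a).
Proof.
move=> c x y; apply: exteriorP => S; rewrite extD extZ !contractE extD extZ.
by case: ifP => _; rewrite ?mulr0 ?addr0 // mulrDr mulrCA.
Qed.
HB.instance Definition _ a :=
  GRing.isLinear.Build k E E _ (contract a) (contract_is_linear a).

(** [contract a] is the interior product with the dual vector of e_a, and [ext_diff] is the one with
    the sum of these dual vectors. Linearity of [ext_diff] follows. *)
Lemma ext_diff_contract x : ext_diff x = \sum_a contract a x.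
Proof.
apply: exteriorP => S; rewrite ext_sum ffunE big_mkcond.
by apply: eq_bigr => a _; rewrite contractE; case: (a \in S).
Qed.

Lemma ext_diff_is_linear : linear (@ext_diff k n).
Proof.
move=> c x y; rewrite !ext_diff_contract scaler_sumr -big_split.
by apply: eq_bigr => a _; rewrite linearP.
Qed.
HB.instance Definition _ :=
  GRing.isLinear.Build k E E _ (@ext_diff k n) ext_diff_is_linear.

Lemma card_below_setD1 i S (p : pred 'I_n) : i \in S ->
  #|[set j in S | p j]| = (p i + #|[set j in S :\ i | p j]|)%N.
Proof.
move=> iS; rewrite (cardsD1 i) inE iS; congr (_ + #|pred_of_set _|)%N.
by apply/setP=> j; rewrite !inE andbA.
Qed.

(** The antiderivation rule of an interior product. For distinct a and b exactly one of a < b and b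
    < a holds, which accounts for the minus sign. *)
Lemma contract_gen a b x :
  contract a (ext_gen k b * x) = (a == b)%:R *: x - ext_gen k b * contract a x.
Proof.
apply: exteriorP => U; rewrite extD extN extZ ext_genME !contractE ext_genME.
have [<-{b}|nab] := eqVneq a b; last first.
  rewrite mul0r add0r !inE eq_sym (negPf nab) /=.
  case: ifPn => aU; case: ifPn => bU; rewrite ?mulr0 ?oppr0 //.
  have -> : (a |: U) :\ b = a |: U :\ b.
    by apply/setP=> c; rewrite !inE; case: eqP => [->|] //=; case: eqP => // e;
       rewrite e eqxx in nab.
  rewrite !mulrA -!exprD -mulNr; congr (_ * _).
  rewrite -[RHS]mulN1r -exprS -[LHS]signr_odd -[RHS]signr_odd.
  congr (_ ^+ (nat_of_bool _)); rewrite /= !oddD.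
  have aaU : a \in a |: U by rewrite setU11.
  rewrite (card_below_setD1 (fun j => j < b)%N aaU) setU1K //.
  rewrite (card_below_setD1 (fun j => j < a)%N bU) !oddD !oddb.
  rewrite -val_eqE /= in nab.
  by case: ltngtP nab => //= _ _; case: odd; case: odd.
rewrite setU11 mul1r setD11; case: ifPn => aU.
  rewrite setD1K //.
  have -> : [set j in U :\ a | (j < a)%N] = [set j in U | (j < a)%N].
    by apply/setP=> j; rewrite !inE; case: eqP => [->|] //=; rewrite ltnn andbF.
  by rewrite mulrA -expr2 sqrr_sign mul1r subrr.
rewrite subr0 setU1K //.
have -> : [set j in a |: U | (j < a)%N] = [set j in U | (j < a)%N].
  by apply/setP=> j; rewrite !inE; case: eqP => [->|] //=; rewrite ltnn andbF.
by rewrite mulrA -expr2 sqrr_sign mul1r.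
Qed.

(** Euler's identity: contracting by a and multiplying back by e_a restores the coefficient at S if
    a lies in S and kills it otherwise. *)
Lemma gen_contract_sum x S :
  (\sum_a ext_gen k a * contract a x) S = #|S|%:R * x S.
Proof.
rewrite ext_sum (bigID (mem S)) /= [X in _ + X]big1 ?addr0 => [|a aS]; last first.
  by rewrite ext_genME (negPf aS).
rewrite (eq_bigr (fun=> x S)) ?sumr_const ?mulr_natl // => a aS.
rewrite ext_genME aS contractE setD11 setD1K //.
have -> : [set j in S :\ a | (j < a)%N] = [set j in S | (j < a)%N].
  by apply/setP=> j; rewrite !inE; case: eqP => [->|] //=; rewrite ltnn andbF.
by rewrite mulrA -expr2 sqrr_sign mul1r.
Qed.

Lemma gen_anticomm a b : ext_gen k a * ext_gen k b = - (ext_gen k b * ext_gen k a).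
Proof.
have [->|ne] := eqVneq a b; first by rewrite ext_gen_sqr oppr0.
exact: ext_gen_anticomm.
Qed.

(* M (x) Gamma_q is modelled by the symmetric functions on sequences of size q,
   regardless of their values on sequences of another size. *)
Definition symmetric_fun (T : Type) (u : seq 'I_n -> T) :=
  forall s t, perm_eq s t -> u s = u t.

(** The Cartan differential. A family lists the coefficients on divided monomials, so the derivative
    along b is evaluation at [b :: s]. *)
Definition koszul (M : lmodType E) (x : seq 'I_n -> M) s : M :=
  \sum_b ext_gen k b *: x (b :: s).

Lemma symmetric_koszul (M : lmodType E) (x : seq 'I_n -> M) :
  symmetric_fun x -> symmetric_fun (koszul x).
Proof.
by move=> sx s t st; apply: eq_bigr => b _; congr (_ *: _); apply: sx; rewrite perm_cons.
Qed.

(** Multiplying a divided monomial by the variable b brings out the new multiplicity of b, whence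
    the factor [count_mem b s]; it also cancels the default value of [rem b s] for b outside s. *)
Definition homotopy (u : seq 'I_n -> E) s : E :=
  \sum_b (count_mem b s)%:R *: contract b (u (rem b s)).

Lemma symmetric_homotopy u : symmetric_fun u -> symmetric_fun (homotopy u).
Proof.
move=> su s t st; apply: eq_bigr => b _; rewrite (permP st).
congr (_ *: contract b _); apply: su; apply/permP => p.
by rewrite !count_rem (permP st) (perm_mem st).
Qed.

Lemma koszul_regularE (u : seq 'I_n -> E) s :
  koszul (u : _ -> E^o) s = \sum_b ext_gen k b * u (b :: s).
Proof. by []. Qed.

(** The anticommutator is the total degree in E and Gamma: the mixed terms cancel by the
    antiderivation rule, and two Euler identities remain. *)
Lemma koszul_homotopyE (u : seq 'I_n -> E) s S : symmetric_fun u ->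
  (koszul (homotopy u : seq 'I_n -> E^o) s + homotopy (koszul (u : _ -> E^o)) s) S
    = (#|S| + size s)%:R * u s S.
Proof.
move=> su.
(* The count of b in [a :: s] exceeds that in s by one exactly when b = a; this excess is the first
   sum. *)
have -> : koszul (homotopy u : seq 'I_n -> E^o) s =
   \sum_a ext_gen k a * contract a (u s) +
   \sum_a \sum_b (count_mem b s)%:R *: (ext_gen k a * contract b (u (a :: rem b s))).
  rewrite koszul_regularE -big_split; apply: eq_bigr => a _ /=.
  rewrite /homotopy mulr_sumr (bigD1 a) //= eqxx.
  rewrite [in RHS](bigD1 a) //= addrA; congr (_ + _).
    rewrite natrD scalerDl scale1r mulrDr -scalerAr; congr (_ + _).
    have [as_|/count_memPn->] := boolP (a \in s); last by rewrite !scale0r.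
    by rewrite (su _ _ (perm_to_rem as_)).
  apply: eq_bigr => b ba; rewrite eq_sym (negPf ba) add0n -scalerAr.
  by [].
have -> : homotopy (koszul (u : _ -> E^o)) s =
   \sum_b (count_mem b s)%:R *: u (b :: rem b s) -
   \sum_a \sum_b (count_mem b s)%:R *: (ext_gen k a * contract b (u (a :: rem b s))).
  rewrite exchange_big /= -sumrB; apply: eq_bigr => b _.
  rewrite koszul_regularE linear_sum /=.
  under eq_bigr do rewrite contract_gen.
  rewrite sumrB scalerBr; congr (_ - _); last by rewrite scaler_sumr.
  congr (_ *: _); rewrite (bigD1 b) //= eqxx scale1r big1 ?addr0 // => a ab.
  by rewrite eq_sym (negPf ab) scale0r.
rewrite addrA addrAC addrK extD gen_contract_sum natrD mulrDl; congr (_ + _).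
have -> : \sum_b (count_mem b s)%:R *: u (b :: rem b s) =
    \sum_b (count_mem b s)%:R *: u s.
  apply: eq_bigr => b _; have [bs|/count_memPn->] := boolP (b \in s).
    by congr (_ *: _); apply/su; rewrite perm_sym perm_to_rem.
  by rewrite !scale0r.
rewrite -scaler_suml extZ -natr_sum; congr (_%:R * _).
rewrite -[RHS](count_predT s); elim: s {su} => [|c s IH] /=.
  by rewrite big1.
by rewrite big_split /= IH; congr (_ + _)%N; rewrite (bigD1 c) //= eqxx big1 // => b;
   rewrite eq_sym => /negPf->.
Qed.

End Contraction.

(** * Koszul complexes of graded free modules *)

Section FreeModules.
Variables (k : fieldType) (n : nat).
Hypothesis char0 : [pchar k] =i pred0.
Local Notation E := (exterior k n).
Local Notation aug := (@ext_aug k n).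

Lemma natr_neq0 m : (0 < m)%N -> m%:R != 0 :> k.
Proof. by rewrite ((pcharf0P k).1 char0) lt0n. Qed.

Lemma eq_opp_eq0 (c : k) : c = - c -> c = 0.
Proof.
move=> e; have /eqP : c *+ 2 = 0 by rewrite mulr2n {2}e subrr.
by rewrite -mulr_natr mulf_eq0 (negPf (natr_neq0 _)) // orbF => /eqP.
Qed.

Lemma gen_mulC_scalar b (c : k) : ext_gen k b * c%:A = c%:A * ext_gen k b :> E.
Proof. by rewrite -scalerAl -scalerAr mulr1 mul1r. Qed.

Lemma cardsDS_add (S T : {set 'I_n}) : T \subset S -> (#|T| + #|S :\: T| = #|S|)%N.
Proof. by move=> sTS; rewrite -(cardsID T S) (setIidPr sTS). Qed.

(** * The Cartan complex of a free module of finite rank *)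

Section Koszul.
Variable r : nat.
Implicit Types (x y : seq 'I_n -> 'rV[E]_r) (s : seq 'I_n).

Lemma eq_koszul x y s : (forall b, x (b :: s) = y (b :: s)) -> koszul x s = koszul y s.
Proof. by move=> xy; apply: eq_bigr => b _; rewrite xy. Qed.

(** Row vectors form a module over [E], so scalars of [k] act through the central elements
    [c%:A]. *)
Lemma koszul_linear x y s (c : k) :
  koszul (fun t => c%:A *: x t + y t) s = c%:A *: koszul x s + koszul y s.
Proof.
rewrite scaler_sumr -big_split; apply: eq_bigr => b _ /=.
by rewrite scalerDr !scalerA gen_mulC_scalar.
Qed.

Lemma koszulB x y s : koszul (fun t => x t - y t) s = koszul x s - koszul y s.
Proof. by rewrite -sumrB; apply: eq_bigr => b _; rewrite scalerBr. Qed.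

Lemma koszulM r' x s (A : 'M[E]_(r, r')) :
  koszul x s *m A = koszul (fun t => x t *m A) s.
Proof. by rewrite mulmx_suml; apply: eq_bigr => b _; rewrite scalemxAl. Qed.

(** The generators anticommute while x is symmetric in its two new arguments, so the double sum
    equals its opposite. *)
Lemma koszul_koszul x s : symmetric_fun x -> koszul (koszul x) s = 0.
Proof.
move=> sx; set v := koszul _ s.
have e : v = - v.
  rewrite {1}/v /koszul; under eq_bigr do rewrite scaler_sumr.
  rewrite exchange_big /= /v -sumrN; apply: eq_bigr => b _ /=.
  rewrite scaler_sumr -sumrN; apply: eq_bigr => c _.
  rewrite !scalerA gen_anticomm scaleNr; congr (- (_ *: _)).
  by apply: sx; rewrite (perm_catCA [:: b] [:: c] s).
apply/rowP => a; apply: exteriorP => S; rewrite [in RHS]mxE ext0; apply: eq_opp_eq0.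
by rewrite {1}e [(- v) 0 a]mxE extN.
Qed.

Lemma koszul_row x s a : koszul x s 0 a = \sum_b ext_gen k b * x (b :: s) 0 a.
Proof. by rewrite summxE; apply: eq_bigr => b _; rewrite mxE. Qed.

Lemma aug_koszul x s : map_mx aug (koszul x s) = 0.
Proof.
apply/rowP => a; rewrite !mxE koszul_row raddf_sum big1 // => b _.
by rewrite [LHS]ext_genME inE.
Qed.

Lemma aug_scalar (c : k) : aug c%:A = c.
Proof. by rewrite /ext_aug extZ ffunE eqxx mulr1. Qed.

End Koszul.

(* The degree [j] part of M (x) Gamma, with M free on generators of degrees [deg]. *)
Definition homog_fun (j r : nat) (deg : 'I_r -> nat) (x : seq 'I_n -> 'rV[E]_r) :=
  forall s a (S : {set 'I_n}), j != (#|S| + deg a + size s)%N -> x s 0 a S = 0.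

Definition homog_mx r r' (deg : 'I_r -> nat) (deg' : 'I_r' -> nat) (A : 'M[E]_(r, r')) :=
  forall a b (S : {set 'I_n}), A a b S != 0 -> deg a = (#|S| + deg' b)%N.

Section Homogeneous.
Variables (j r : nat) (deg : 'I_r -> nat).
Implicit Types (x y : seq 'I_n -> 'rV[E]_r) (s : seq 'I_n).

Lemma homog_koszul x : homog_fun j deg x -> homog_fun j deg (koszul x).
Proof.
move=> hx s a S ne; rewrite koszul_row ext_sum big1 // => b _; rewrite ext_genME.
case: ifP => // bS; rewrite hx ?mulr0 //=; apply: contra ne => /eqP->.
by rewrite (cardsD1 b S) bS addnS add1n !addSn.
Qed.

Lemma homog_linear x y (c : k) : homog_fun j deg x -> homog_fun j deg y ->
  homog_fun j deg (fun s => c%:A *: x s + y s).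
Proof.
by move=> hx hy s a S ne; rewrite !mxE -scalerAl mul1r extD extZ hx // hy // mulr0 addr0.
Qed.

Lemma homogB x y : homog_fun j deg x -> homog_fun j deg y ->
  homog_fun j deg (fun s => x s - y s).
Proof. by move=> hx hy s a S ne; rewrite !mxE extD extN hx // hy // subr0. Qed.

(** The preimage is the homotopy divided by the total degree [j - deg a] of each coordinate. That
    degree can vanish only on constants in Gamma-degree 0, which the augmentation hypothesis
    excludes. *)
Lemma koszul_exact q x : symmetric_fun x -> homog_fun j deg x ->
  (forall s, (size s).+1 = q -> koszul x s = 0) ->
  (q = 0 -> map_mx aug (x [::]) = 0) ->
  exists y, [/\ symmetric_fun y, homog_fun j deg y
    & forall s, size s = q -> koszul y s = x s].
Proof.
move=> sx hx dx0 x0; pose xa a t := x t 0 a.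
have sxa a : symmetric_fun (xa a) by move=> s t st; rewrite /xa (sx _ _ st).
exists (fun s => \row_a ((j - deg a)%N%:R^-1 *: homotopy (xa a) s)); split.
- move=> s t st; apply/rowP => a; rewrite !mxE; congr (_ *: _).
  exact: symmetric_homotopy.
- move=> s a S ne; rewrite mxE extZ ext_sum big1 ?mulr0 // => b _; rewrite extZ.
  have [bs|/count_memPn->] := boolP (b \in s); last by rewrite mul0r.
  rewrite contractE; case: ifP => bS; rewrite ?mulr0 // /xa hx ?mulr0 //.
  apply: contra ne => /eqP->; rewrite cardsU1 bS size_rem //.
  by case: s bs => // c s _; rewrite /= addnS add1n !addSn.
move=> s sq; apply/rowP => a; rewrite koszul_row.
under eq_bigr do rewrite mxE -scalerAr.
rewrite -scaler_sumr -koszul_regularE; apply: exteriorP => S; rewrite extZ.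
have := koszul_homotopyE s S (sxa a); rewrite extD.
rewrite [X in _ + X = _](_ : _ = 0) ?addr0 => [->|]; last first.
  rewrite [homotopy _ _](_ : _ = 0) ?ext0 //; apply: big1 => b _.
  have [bs|/count_memPn->] := boolP (b \in s); last by rewrite scale0r.
  rewrite koszul_regularE -koszul_row dx0 ?mxE ?linear0 ?scaler0 //.
  by rewrite size_rem // prednK //; case: s bs {sq}.
(* Only a nonzero coefficient forces j = |S| + deg a + size s, so that the truncated [j - deg a] is
   the factor of the homotopy formula. *)
have [->|nz] := eqVneq (xa a s S) 0; first by rewrite -/(xa a s) !mulr0.
have ej : j = (#|S| + deg a + size s)%N by apply/eqP; apply: contraNT nz => /hx/eqP.
rewrite ej addnAC addnK mulKf //; apply: natr_neq0; rewrite lt0n addn_eq0.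
apply: contra nz => /andP[]; rewrite cards_eq0 => /eqP-> /nilP es.
by have /rowP/(_ a) := x0 (etrans (esym sq) (congr1 size es)); rewrite !mxE /xa es => e0; apply/eqP.
Qed.

Definition homog_part q (v : 'rV[E]_r) : 'rV[E]_r :=
  \row_a [ffun S : {set 'I_n} => if j == (#|S| + deg a + q)%N then v 0 a S else 0].

Lemma homog_part_id x s : homog_fun j deg x -> homog_part (size s) (x s) = x s.
Proof.
move=> hx; apply/rowP => a; apply: exteriorP => S; rewrite mxE ffunE.
by case: ifPn => // /hx->.
Qed.

Variables (r' : nat) (deg' : 'I_r' -> nat) (A : 'M[E]_(r, r')).
Hypothesis hA : homog_mx deg deg' A.

Lemma homog_mulmx x : homog_fun j deg x -> homog_fun j deg' (fun s => x s *m A).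
Proof.
move=> hx s b S ne; rewrite mxE ext_sum big1 // => a _.
rewrite ffunE big1 // => T sTS; have [->|nz] := eqVneq (A a b (S :\: T)) 0.
  by rewrite !mulr0.
rewrite hx ?mul0r ?mulr0 //; apply: contra ne => /eqP->; apply/eqP.
by rewrite (hA nz) addnA cardsDS_add.
Qed.

End Homogeneous.

(** Along a nonzero entry of [A] the degree conditions in source and target coincide, so [A]
    commutes with the projections. *)
Lemma homog_part_mulmx j r (deg : 'I_r -> nat) r' (deg' : 'I_r' -> nat)
    (A : 'M[E]_(r, r')) q v : homog_mx deg deg' A ->
  homog_part j deg q v *m A = homog_part j deg' q (v *m A).
Proof.
move=> hA; apply/rowP => b; apply: exteriorP => S; rewrite !mxE ffunE ext_sum.
rewrite (ext_sum _ _ (fun a => v 0 a * A a b)).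
under eq_bigr do rewrite mxE ffunE.
under [in RHS]eq_bigr do rewrite ffunE.
case: ifPn => ej; last first.
  rewrite big1 // => a _; rewrite big1 // => T sTS; rewrite ffunE.
  have [->|nz] := eqVneq (A a b (S :\: T)) 0; first by rewrite !mulr0.
  case: eqP => [e|]; last by rewrite mul0r mulr0.
  by rewrite e (hA _ _ _ nz) addnA cardsDS_add ?eqxx in ej.
apply: eq_bigr => a _; apply: eq_bigr => T sTS; rewrite ffunE.
have [->|nz] := eqVneq (A a b (S :\: T)) 0; first by rewrite !mulr0.
case: eqP => // - []; rewrite (eqP ej) (hA _ _ _ nz) addnA.
by rewrite cardsDS_add.
Qed.

(** Preimages are chosen as a function of the value [t s] rather than of s, so they inherit the
    symmetry of t; projecting them makes them homogeneous. *)
Lemma homog_lift j r (deg : 'I_r -> nat) r' (deg' : 'I_r' -> nat)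
    (A : 'M[E]_(r, r')) (P : pred (seq 'I_n)) (t : seq 'I_n -> 'rV[E]_r') :
    homog_mx deg deg' A -> symmetric_fun t -> homog_fun j deg' t ->
    (forall s, P s -> exists w, t s = w *m A) ->
  exists y, [/\ symmetric_fun y, homog_fun j deg y & forall s, P s -> t s = y s *m A].
Proof.
move=> hA st ht ex.
have ex_pre (u : 'rV_r') : exists v, (exists w, u = w *m A) -> u = v *m A.
  by have [[w uw]|nw] := EM (exists w, u = w *m A); [exists w | exists 0 => /nw].
have [pre preP] := choice ex_pre.
exists (fun s => homog_part j deg (size s) (pre (t s))); split.
- by move=> s s' ss'; rewrite (st _ _ ss') (perm_size ss').
- by move=> s a S ne; rewrite mxE ffunE (negPf ne).
move=> s Ps; rewrite (homog_part_mulmx _ _ _ hA) -preP ?homog_part_id //.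
exact: ex.
Qed.

End FreeModules.

(** * The zigzag of the double complex *)

Section Zigzag.
Variables (k : fieldType) (n : nat).
Hypothesis char0 : [pchar k] =i pred0.
Local Notation E := (exterior k n).
Local Notation aug := (@ext_aug k n).

(** Exactness is asked only at positive positions, so that the complex without its first module is
    again of this kind; inductions on the length of a zigzag use this. *)
Record free_complex := FreeComplex {
  fc_rank : nat -> nat;
  fc_deg : forall p, 'I_(fc_rank p) -> nat;
  fc_diff : forall p, 'M[E]_(fc_rank p.+1, fc_rank p);
  fc_homog : forall p, homog_mx (@fc_deg p.+1) (@fc_deg p) (fc_diff p);
  fc_exact : forall p (v : 'rV_(fc_rank p.+1)),
    v *m fc_diff p = 0 <-> exists w, v = w *m fc_diff p.+1 }.

Definition fc_shift (C : free_complex) : free_complex :=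
  FreeComplex (fun p => @fc_homog C p.+1) (fun p => @fc_exact C p.+1).

Variable j : nat.

Definition chain_group (C : free_complex) (x : seq 'I_n -> 'rV[E]_(fc_rank C 0)) :=
  symmetric_fun x /\ homog_fun j (@fc_deg C 0) x.

(* The zigzag relation of the double complex C (x) Gamma between bidegree (0, q)
   and the reduction of C_q modulo the augmentation ideal. *)
Fixpoint zigzag q (C : free_complex) :
    (seq 'I_n -> 'rV[E]_(fc_rank C 0)) -> 'rV[k]_(fc_rank C q) -> Prop :=
  match q with
  | 0 => fun x v => v = map_mx aug (x [::])
  | q'.+1 => fun x v => exists y : seq 'I_n -> 'rV[E]_(fc_rank C 1),
      [/\ @chain_group (fc_shift C) y,
          forall s, size s = q' -> koszul x s = y s *m fc_diff C 0
        & @zigzag q' (fc_shift C) y v]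
  end.
Arguments zigzag : clear implicits.

Definition red_diff C p : 'M[k]_(fc_rank C p.+1, fc_rank C p) := map_mx aug (fc_diff C p).

Definition in_degree C p (v : 'rV[k]_(fc_rank C p)) := forall a, fc_deg a != j -> v 0 a = 0.

(** In Gamma-degree q, x vanishes modulo the images of the two differentials entering bidegree (0,
    q). *)
Definition is_bound q C (x : seq 'I_n -> 'rV[E]_(fc_rank C 0)) :=
  exists y z, [/\ @chain_group (fc_shift C) y, @chain_group C z
    & forall s, size s = q -> x s = y s *m fc_diff C 0 + koszul z s].

Lemma zigzag_linear q C x x' v v' (c : k) : zigzag q C x v -> zigzag q C x' v' ->
  zigzag q C (fun s => c%:A *: x s + x' s) (c *: v + v').
Proof.
elim: q C x x' v v' => [|q IHq] C x x' v v' /=.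
  by move=> -> ->; apply/rowP => a; rewrite !mxE rmorphD rmorphM [in RHS]/= aug_scalar.
move=> [y [[sy hy] dx zy]] [y' [[sy' hy'] dx' zy']].
exists (fun s => c%:A *: y s + y' s); split; last exact: IHq.
  split; last exact: homog_linear.
  by move=> s t st; rewrite (sy _ _ st) (sy' _ _ st).
by move=> s sq; rewrite koszul_linear dx // dx' // mulmxDl scalemxAl.
Qed.

(** The lift y of [koszul x] satisfies the same hypothesis one step further: its Koszul image is
    killed by the differential, as [koszul (koszul x)] = 0, and exactness of C applies. The [match]
    says that v is a cycle when q > 0. *)
Lemma zigzag_left q C x : @chain_group C x ->
    (forall s, (size s).+1 = q -> exists w, koszul x s = w *m fc_diff C 0) ->
  exists v, [/\ zigzag q C x v, in_degree v &
    match q return 'rV[k]_(fc_rank C q) -> Prop with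
    | 0 => fun=> True
    | q'.+1 => fun v => v *m red_diff C q' = 0 end v].
Proof.
elim: q C x => [|q IHq] C x [sx hx] ex.
  exists (map_mx aug (x [::])); split=> // a ne; rewrite mxE; apply: hx.
  by rewrite cards0 addn0 eq_sym.
have [y [sy hy dx]] := homog_lift (P := fun s => size s == q) (@fc_homog C 0)
  (symmetric_koszul sx) (homog_koszul hx) (fun s sq => ex s (congr1 S (eqP sq))).
have [s sq|v [zv dv cv]] := IHq (fc_shift C) y (conj sy hy).
  apply/fc_exact; rewrite koszulM -(koszul_koszul char0 s sx).
  by apply: eq_koszul => b; rewrite dx //= sq.
exists v; split=> //=.
  exists y; split=> // s /eqP; exact: dx.
case: q {IHq ex} dx v zv {dv} cv => [|q] dx v //=.
by move=> -> _; rewrite -map_mxM -dx // aug_koszul.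
Qed.

Definition constant_chain r (v : 'rV[k]_r) (s : seq 'I_n) : 'rV[E]_r :=
  if s is [::] then \row_a (v 0 a)%:A else 0.

Lemma constant_chain_group C (v : 'rV[k]_(fc_rank C 0)) : in_degree v ->
  @chain_group C (constant_chain v).
Proof.
move=> dv; split=> [s t st|s a S].
  by case: s t st => [|b s] [|c t] // /perm_size.
case: s => [|b s] /=; rewrite mxE ?ext0 // extZ ffunE.
have [->|] := eqVneq S set0; last by rewrite mulr0.
by rewrite cards0 addn0 eq_sym => /dv->; rewrite mul0r.
Qed.

Lemma aug_constant_chain r (v : 'rV[k]_r) : map_mx aug (constant_chain v [::]) = v.
Proof. by apply/rowP => a; rewrite !mxE aug_scalar. Qed.

Lemma chain_groupM C y : @chain_group (fc_shift C) y ->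
  @chain_group C (fun s => y s *m fc_diff C 0).
Proof.
case=> sy hy; split; last exact: (homog_mulmx (@fc_homog C 0) hy).
by move=> s t st; rewrite (sy _ _ st).
Qed.

Lemma chain_groupB C x y : @chain_group C x -> @chain_group C y ->
  @chain_group C (fun s => x s - y s).
Proof.
move=> [sx hx] [sy hy]; split; last exact: homogB.
by move=> s t st; rewrite (sx _ _ st) (sy _ _ st).
Qed.

Lemma chain_group_koszul C x : @chain_group C x -> @chain_group C (koszul x).
Proof.
by move=> [sx hx]; split; [exact: symmetric_koszul | exact: homog_koszul].
Qed.

(** The zigzag is built from its other end: v is placed in Gamma-degree 0, and each image under the
    differential of C is a Koszul cycle, hence a Koszul boundary. *)
Lemma zigzag_right q C (v : 'rV[k]_(fc_rank C q.+1)) :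
    in_degree v -> v *m red_diff C q = 0 ->
  exists x, @chain_group C x /\ zigzag q.+1 C x v.
Proof.
elim: q C v => [|q IHq] C v dv cv.
  have gv : @chain_group (fc_shift C) (constant_chain v) by exact: constant_chain_group.
  have [sv hv] := chain_groupM gv.
  have [||x [sx hx dx]] := koszul_exact (q := 0) char0 sv hv.
  - by [].
  - by move=> _; rewrite map_mxM aug_constant_chain.
  exists x; split=> //; exists (constant_chain v); split=> //=.
  by rewrite aug_constant_chain.
have [y [gy zy]] := IHq (fc_shift C) v dv cv.
have [sy hy] := chain_groupM gy.
have [s [sq]||x [sx hx dx]] := koszul_exact (q := q.+1) char0 sy hy.
- rewrite -koszulM; case: zy => z [gz -> //  _].
  by apply/fc_exact; exists (z s).
- by [].
by exists x; split=> //; exists y.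
Qed.

(** By induction the next term y of the zigzag is bounded, with Koszul part z; then x minus the
    image of z is a Koszul cycle, hence a Koszul boundary. *)
Lemma bound_of_zigzag q C x (w : 'rV[k]_(fc_rank C q.+1)) : in_degree w ->
  @chain_group C x -> zigzag q C x (w *m red_diff C q) -> is_bound q x.
Proof.
elim: q C x w => [|q IHq] C x w dw gx /=.
  move=> xw; have gw : @chain_group (fc_shift C) (constant_chain w).
    exact: constant_chain_group.
  have [sd hd] := chain_groupB gx (chain_groupM gw).
  have [||z [sz hz dz]] := koszul_exact (q := 0) char0 sd hd.
  - by [].
  - by move=> _; rewrite map_mxB map_mxM aug_constant_chain -xw subrr.
  exists (constant_chain w), z; split=> // s sq.
  by rewrite dz // addrC subrK.
case=> y [gy dx /(IHq (fc_shift C) y w dw gy) [y' [z [gy' gz ey]]]].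
have [sd hd] := chain_groupB gx (chain_groupM gz).
have [s [sq]||z' [sz' hz' dz']] := koszul_exact (q := q.+1) char0 sd hd.
- rewrite koszulB dx // ey // mulmxDl -koszulM.
  rewrite (_ : y' s *m _ *m _ = 0) ?add0r ?subrr //.
  by apply/fc_exact; exists (y' s).
- by [].
by exists z, z'; split=> // s sq; rewrite dz' // addrC subrK.
Qed.

(** If x = y' d + [koszul z], then y - [koszul y'] is killed by d and hence comes from C_2. So the
    next term y of the zigzag is bounded too. *)
Lemma zigzag_bound q C x v : @chain_group C x -> is_bound q x -> zigzag q C x v ->
  exists2 w : 'rV[k]_(fc_rank C q.+1), in_degree w & v = w *m red_diff C q.
Proof.
elim: q C x v => [|q IHq] C x v gx [y' [z [gy' gz ex]]] /=.
  move=> ->; exists (map_mx aug (y' [::])).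
    move=> a ne; rewrite mxE; apply: gy'.2; by rewrite cards0 addn0 eq_sym.
  by rewrite ex // map_mxD aug_koszul addr0 map_mxM.
case=> y [gy dx zy]; apply: IHq zy => //.
have [sd hd] := chain_groupB gy (chain_group_koszul gy').
have [s /eqP sq|y'' [sy hy ey]] := homog_lift (P := fun s => size s == q)
    (@fc_homog C 1) sd hd.
  apply/fc_exact; rewrite mulmxBl -dx // koszulM.
  rewrite (@eq_koszul _ _ _ x (fun t => y' t *m fc_diff C 0 + koszul z t)); last first.
    by move=> b; rewrite ex //= sq.
  rewrite {1}/koszul; under eq_bigr do rewrite scalerDr.
  rewrite big_split /= -/(koszul (koszul z) s) koszul_koszul ?addr0 ?subrr //.
  by case: gz.
exists y'', y'; split=> // s sq.
by rewrite -ey ?sq // subrK.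
Qed.

End Zigzag.

(** * Linear relations between row vectors *)

Section LinearRelation.
Variables (k : fieldType) (r N z b : nat) (Z : 'M[k]_(z, r)) (B : 'M[k]_(b, r)).
Variable rel : 'rV[k]_r -> 'rV[k]_N -> Prop.
Hypotheses (rel0 : rel 0 0) (sBZ : (B <= Z)%MS).
Hypothesis rel_linear : forall c v v' w w',
  rel v w -> rel v' w' -> rel (c *: v + v') (c *: w + w').

(** A zigzag involves choices, so cycles and coefficient vectors are compared by a linear relation
    [rel] instead of a map. *)
Lemma rel_mulmx d (A : 'M_(d, r)) (C : 'M_(d, N)) :
  (forall i, rel (row i A) (row i C)) -> forall u, rel (u *m A) (u *m C).
Proof.
move=> AC u; rewrite !mulmx_sum_row.
elim: (index_enum _) => [|i s IHs]; first by rewrite !big_nil.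
by rewrite !big_cons; apply: rel_linear.
Qed.

Section Injective.
Hypotheses (rel_ex : forall w, exists v, (v <= Z)%MS /\ rel v w)
  (rel_inj : forall v w, (v <= B)%MS -> rel v w -> w = 0).

(** The rows of A are related to the standard basis vectors. Since [rel] is injective modulo B, A is
    free and its row space meets B trivially. *)
Lemma rel_section : exists A : 'M_(N, r),
  [/\ forall w, rel (w *m A) w, (A + B <= Z)%MS & \rank (A + B)%MS = (N + \rank B)%N].
Proof.
have [f fP] := choice rel_ex.
pose A := \matrix_i f (delta_mx 0 i).
have relA w : rel (w *m A) w.
  rewrite -{2}[w]mulmx1; apply: rel_mulmx => i.
  by rewrite rowK row1; case: (fP (delta_mx 0 i)).
have inj (w : 'rV_N) : (w *m A <= B)%MS -> w = 0 by move=> wB; exact: rel_inj wB (relA w).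
exists A; split=> //.
  rewrite addsmx_sub sBZ andbT; apply/row_subP => i; rewrite rowK.
  by case: (fP (delta_mx 0 i)).
have rA : \rank A = N.
  apply/eqP; rewrite -/(row_free A) -kermx_eq0; apply/eqP/row_matrixP => i.
  rewrite row0; apply: inj; have /sub_kermxP-> := row_sub i (kermx A).
  exact: sub0mx.
rewrite mxrank_disjoint_sum ?rA //; apply/eqP; rewrite -submx0.
apply/row_subP => i; have := row_sub i (A :&: B)%MS.
by rewrite sub_capmx => /andP[/submxP[w ->]] /inj->; rewrite mul0mx sub0mx.
Qed.

Lemma rel_rank_ge : (N <= \rank Z - \rank B)%N.
Proof.
have [A [_ sZ rk]] := rel_section.
by rewrite leq_subRL ?mxrankS // addnC -rk mxrankS.
Qed.

(** When the rank bound is attained, the section and B together span Z. *)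
Lemma rel_rank_eq v : N = (\rank Z - \rank B)%N -> (v <= Z)%MS ->
  exists w v', rel v' w /\ (v - v' <= B)%MS.
Proof.
move=> eN vZ; have [A [relA sZ rk]] := rel_section.
have : (v <= A + B)%MS.
  apply: submx_trans vZ _; rewrite -(geq_leqif (mxrank_leqif_sup sZ)) rk eN subnK //.
  exact: mxrankS.
case/sub_addsmxP => -[u u'] /= ->; exists u, (u *m A); split=> //.
by rewrite addrC addKr submxMl.
Qed.

End Injective.

(** A basis of a complement of B in Z is related to a free family of vectors of size N. *)
Lemma rel_rank_le : (forall v, (v <= Z)%MS -> exists w, rel v w) ->
  (forall v, (v <= Z)%MS -> rel v 0 -> (v <= B)%MS) -> (\rank Z - \rank B <= N)%N.
Proof.
move=> rel_ex rel_ker; pose A := row_base (Z :\: B)%MS.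
have AZ : (A <= Z)%MS by rewrite eq_row_base diffmxSl.
have exA i : exists w, rel (row i A) w.
  by apply: rel_ex; apply: submx_trans (row_sub _ _) AZ.
have [f fP] := choice exA.
pose C := \matrix_i f i.
have relC u : rel (u *m A) (u *m C) by apply: rel_mulmx => i; rewrite rowK.
have freeC : row_free C.
  rewrite -kermx_eq0; apply/eqP/row_matrixP => i; rewrite row0.
  set u := row i _; have uC : u *m C = 0 by apply/sub_kermxP/row_sub.
  have uAZ : (u *m A <= Z)%MS by apply: submx_trans AZ; apply: submxMl.
  have uAB : (u *m A <= B)%MS by apply: rel_ker => //; rewrite -uC; apply: relC.
  have : (u *m A <= (Z :\: B) :&: B)%MS.
    by rewrite sub_capmx uAB -(eq_row_base (Z :\: B)%MS) submxMl.
  rewrite capmx_diff submx0 => /eqP uA; apply: (row_free_inj (row_base_free _)).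
  by rewrite mul0mx; exact: uA.
rewrite -(mxrank_cap_compl Z B) (capmx_idPr sBZ) addKn.
by move: freeC => /eqP <-; apply: rank_leq_col.
Qed.

End LinearRelation.

(** * Tensors with zero partial sums on a line *)

Section LocalStrand.
Variables (k : fieldType) (n : nat).
Implicit Types (L : {set 'I_n}) (g : seq 'I_n -> k) (s t : seq 'I_n).

Definition is_base L a := [pick x in L] == Some a.
Definition proper_part L := [set a in L | ~~ is_base L a].
(** For b in the proper part this is the a-coordinate of e_b - e_p, with p the base point of L;
    these vectors are a basis of the zero-sum vectors of L. *)
Definition zero_sum_coef L a b : k := (a == b)%:R - (is_base L a)%:R.

(* The extension of [g], given on sequences in [L] minus its base point, to the
   function on sequences in [L] with all partial sums over [L] equal to zero. *)
Fixpoint zero_sum_ext L g s : k :=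
  if s is a :: s' then
    \sum_(b in proper_part L) zero_sum_coef L a b * zero_sum_ext L (fun t => g (b :: t)) s'
  else g [::].

Lemma is_base_in L a : is_base L a -> a \in L.
Proof. by rewrite /is_base; case: pickP => [x xL /eqP[<-]|]. Qed.

Lemma is_base_inj L a b : is_base L a -> is_base L b -> a = b.
Proof. by rewrite /is_base => /eqP-> /eqP[]. Qed.

Lemma proper_partP L a b : is_base L b -> (a \in proper_part L) = (a \in L) && (a != b).
Proof.
move=> bL; rewrite inE; congr (_ && ~~ _); apply/idP/eqP => [aL|->//].
exact: is_base_inj aL bL.
Qed.

Lemma proper_part_sub L a : a \in proper_part L -> a \in L.
Proof. by rewrite inE => /andP[]. Qed.

Lemma ex_base L a : a \in L -> exists b, is_base L b.
Proof.
by rewrite /is_base; case: pickP => [x _ _|/(_ a)->//]; exists x; rewrite eqxx.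
Qed.

Lemma card_proper_part L : #|proper_part L| = #|L|.-1.
Proof.
have [->|[a /ex_base[b bL]]] := set_0Vmem L.
  by rewrite cards0; apply/eqP; rewrite cards_eq0; apply/eqP/setP=> x; rewrite !inE.
rewrite (cardsD1 b L) (is_base_in bL); congr #|pred_of_set _|.
by apply/setP=> x; rewrite (proper_partP _ bL) !inE andbC.
Qed.

Lemma zero_sum_coef_out L a b : a \notin L -> b \in proper_part L -> zero_sum_coef L a b = 0.
Proof.
move=> aL bL; rewrite /zero_sum_coef (negPf (contraNN (@is_base_in L a) aL)).
case: eqP => [e|_]; last by rewrite subrr.
by rewrite e (proper_part_sub bL) in aL.
Qed.

Lemma eq_zero_sum_ext L g g' s : g =1 g' -> zero_sum_ext L g s = zero_sum_ext L g' s.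
Proof.
elim: s g g' => [|a s IHs] g g' e /=; first exact: e.
by apply: eq_bigr => b _; congr (_ * _); apply: IHs.
Qed.

Lemma zero_sum_ext_linear L (c : k) g g' s :
  zero_sum_ext L (fun t => c * g t + g' t) s = c * zero_sum_ext L g s + zero_sum_ext L g' s.
Proof.
elim: s g g' => [|a s IHs] g g' //=.
rewrite mulr_sumr -big_split; apply: eq_bigr => b _ /=.
by rewrite IHs mulrDr mulrCA.
Qed.

Lemma zero_sum_ext_id L g s : all (mem (proper_part L)) s -> zero_sum_ext L g s = g s.
Proof.
elim: s g => [|a s IHs] g //= /andP[aL sL].
rewrite (bigD1 a) //= big1 => [|b /andP[_ ba]].
  rewrite IHs // addr0 /zero_sum_coef eqxx; move: aL; rewrite inE => /andP[_ /negPf->].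
  by rewrite subr0 mul1r.
rewrite /zero_sum_coef eq_sym (negPf ba); move: aL; rewrite inE => /andP[_ /negPf->].
by rewrite subr0 mul0r.
Qed.

Lemma zero_sum_ext_out L g s a : a \in s -> a \notin L -> zero_sum_ext L g s = 0.
Proof.
elim: s g => [|b s IHs] g //=; rewrite inE => /predU1P[<-|as_] aL.
  by rewrite big1 // => c cL; rewrite zero_sum_coef_out ?mul0r.
by rewrite big1 // => c cL; rewrite IHs ?mulr0.
Qed.

Lemma zero_sum_ext_sum0 L g s : \sum_(a in L) zero_sum_ext L g (a :: s) = 0.
Proof.
rewrite /= exchange_big big1 //= => b bL; rewrite -mulr_suml.
have bL' := proper_part_sub bL; have [c cL] := ex_base bL'.
rewrite sumrB (bigD1 b) //= eqxx big1 => [|a /andP[_ /negPf->//]].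
rewrite (bigD1 c) ?is_base_in //= cL big1 => [|a /andP[_ ac]]; last first.
  by case: (boolP (is_base L a)) => // aL; rewrite (is_base_inj aL cL) eqxx in ac.
by rewrite !addr0 subrr mul0r.
Qed.

Lemma zero_sum_ext_sum1 L g a s : \sum_(b in L) zero_sum_ext L g (a :: b :: s) = 0.
Proof.
transitivity (\sum_(c in proper_part L) zero_sum_coef L a c *
    \sum_(b in L) zero_sum_ext L (fun t => g (c :: t)) (b :: s)).
  by under [RHS]eq_bigr do rewrite mulr_sumr; rewrite exchange_big.
by rewrite big1 // => c _; rewrite zero_sum_ext_sum0 mulr0.
Qed.

(** A permutation is reduced to permutations fixing the head, handled by induction on the size, and
    the exchange of the first two entries, where the double sum is interchanged. *)
Lemma zero_sum_ext_sym L g : symmetric_fun g -> symmetric_fun (zero_sum_ext L g).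
Proof.
move=> sg s; have [m] := ubnP (size s); elim: m s g sg => // m IHm [|a s] g sg /=.
  by move=> _ t /perm_size; case: t.
rewrite ltnS => sm [|b t] /= st; first by have := perm_size st.
have IHc h s' t' c : (size s' < m)%N -> symmetric_fun h -> perm_eq s' t' ->
    zero_sum_ext L h (c :: s') = zero_sum_ext L h (c :: t').
  move=> sm' sh st' /=; apply: eq_bigr => d _; congr (_ * _); apply: IHm => //.
  by move=> u v uv; apply: sh; rewrite perm_cons.
rewrite -/(zero_sum_ext L g (a :: s)) -/(zero_sum_ext L g (b :: t)).
have [eab|nab] := eqVneq a b.
  by rewrite -eab in st *; apply: IHc => //; rewrite perm_cons in st.
have at_ : a \in t.
  by have := perm_mem st a; rewrite !inE eqxx (negPf nab) => /esym.
have tat := perm_to_rem at_.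
have sbt : perm_eq s (b :: rem a t).
  rewrite -(perm_cons a) (perm_trans st) // perm_sym.
  by rewrite (perm_catCA [:: a] [:: b] (rem a t)) /= perm_cons perm_sym.
rewrite (IHc g s _ a _ sg sbt) //.
have -> : zero_sum_ext L g (b :: t) = zero_sum_ext L g (b :: a :: rem a t).
  apply: IHc => //; apply: leq_ltn_trans sm; have := perm_size st => /= -[->].
  by [].
rewrite /=; under eq_bigr do rewrite mulr_sumr.
rewrite exchange_big /=; apply: eq_bigr => c _; rewrite mulr_sumr.
apply: eq_bigr => d _; rewrite mulrCA; congr (_ * (_ * _)).
by apply: eq_zero_sum_ext => u; apply: sg; rewrite (perm_catCA [:: d] [:: c] u).
Qed.

End LocalStrand.

(** * The linear strand of a linear space *)

Arguments zero_sum_ext : simpl never.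

Section LinearStrand.
Variables (k : fieldType) (n : nat).
Hypothesis char0 : [pchar k] =i pred0.
Variable Ls : {set {set 'I_n}}.
Hypotheses (line_ex : forall a b, a != b -> exists L, [/\ L \in Ls, a \in L & b \in L])
  (line_inj : forall L L' a b, L \in Ls -> L' \in Ls -> a != b ->
     a \in L -> b \in L -> a \in L' -> b \in L' -> L = L').
Implicit Types (L : {set 'I_n}) (s t : seq 'I_n) (w : 'I_n -> 'I_n -> seq 'I_n -> k).

(* [w a b s] are the coefficients of an element of the kernel of
   [I_2 (x) Gamma_q -> E_3 (x) Gamma_(q-1)]. *)
Record linear_strand q w : Prop := LinearStrand {
  strand_sym : forall a b, symmetric_fun (w a b);
  strand_alt : forall a b s, w a b s = - w b a s;
  strand_cyc : forall a b c s, (size s).+1 = q ->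
    w a b (c :: s) + w b c (a :: s) + w c a (b :: s) = 0;
  strand_sum : forall L a s, L \in Ls -> a \in L -> size s = q ->
    \sum_(b in L) w a b s = 0 }.

(* Being supported means lying in the sum of the contributions of the lines. *)
Definition supported q w := forall L a b c s, L \in Ls -> a \in L -> b \in L -> a != b ->
  c \in s -> c \notin L -> size s = q -> w a b s = 0.

Lemma strand_diag q w a s : linear_strand q w -> w a a s = 0.
Proof. by move=> sw; apply: eq_opp_eq0 => //; apply: strand_alt sw _ _ _. Qed.

Lemma supported_all : (forall w, linear_strand 1 w -> supported 1 w) ->
  forall q w, (0 < q)%N -> linear_strand q w -> supported q w.
Proof.
move=> sup1 q w q0 sw L a b c s Ll aL bL ab cs cL sq.
rewrite (strand_sym sw a b (perm_to_rem cs)).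
have rq : (size (rem c s)).+1 = q.
  by rewrite size_rem // sq prednK.
apply: (sup1 (fun a b t => w a b (t ++ rem c s)) _ L a b c [:: c]); rewrite ?mem_head //.
split=> [a' b' t t' tt'|a' b' t|a' b' c' t [/size0nil ->]|L' a' t L'l a'L' t1].
- by apply: strand_sym sw _ _ _ _ _; rewrite perm_cat2r.
- exact: strand_alt sw _ _ _.
- exact: strand_cyc sw _ _ _ _ _.
- by apply: strand_sum sw _ _ _ _ _ _ => //; rewrite size_cat t1 add1n.
Qed.

Definition ordle (a b : 'I_n) := (a <= b)%N.
Lemma ordle_total : total ordle. Proof. by move=> a b; apply: leq_total. Qed.
Lemma ordle_trans : transitive ordle. Proof. by move=> a b c; apply: leq_trans. Qed.
Lemma ordle_anti : antisymmetric ordle.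
Proof. by move=> a b ab; apply/val_inj/anti_leq. Qed.

Definition sort_tail s := if s is a :: s' then a :: sort ordle s' else [::].

(** For the reversed order these are the semistandard tableaux of hook shape (q + 1, 1): the tail is
    the row, read backwards from its corner M, and a lies below M. *)
Definition local_index (Y : {set 'I_n}) s :=
  if s is a :: b :: s' then
    [&& all (mem Y) s, sorted ordle (b :: s') & (a < last b s')%N]
  else false.

Section Degree.
Variable q : nat.

(* The coordinate attached to the line L and the tuple (a, t) is w(a, M, t - M), where
   M is the last entry of t. *)
Definition strand_index : {set {set 'I_n} * q.+2.-tuple 'I_n} :=
  [set x | (x.1 \in Ls) && local_index (proper_part x.1) (tval x.2)].

Definition coord w s : k :=
  if s is a :: b :: s' then w a (last b s') (belast b s') else 0.

Definition strand_pot (c : 'rV[k]_#|strand_index|) L s : k :=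
  \sum_j c 0 j *
    (((enum_val j).1 == L) && (tval (enum_val j).2 == sort_tail s))%:R.

(** The Koszul image of a potential in the sum over lines of W (x) Gamma_(q+1). As the potential is
    symmetric in all arguments but the first, the cyclic identity is automatic. *)
Definition strand_of c a b s : k :=
  \sum_(L in Ls) (zero_sum_ext L (strand_pot c L) (a :: b :: s) -
                  zero_sum_ext L (strand_pot c L) (b :: a :: s)).

Lemma strand_pot_sym c L a : symmetric_fun (fun s => strand_pot c L (a :: s)).
Proof.
move=> s t st; apply: eq_bigr => j _; rewrite /sort_tail.
by rewrite ((perm_sortP ordle_total ordle_trans ordle_anti _ _) st).
Qed.

Lemma ext_pot_sym c L a : symmetric_fun (fun s => zero_sum_ext L (strand_pot c L) (a :: s)).
Proof.
move=> s t st; apply: eq_bigr => b _; congr (_ * _).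
by apply: zero_sum_ext_sym st; apply: strand_pot_sym.
Qed.

Lemma strand_of_linear (d : k) c c' a b s :
  strand_of (d *: c + c') a b s = d * strand_of c a b s + strand_of c' a b s.
Proof.
have pot L t : strand_pot (d *: c + c') L t = d * strand_pot c L t + strand_pot c' L t.
  rewrite mulr_sumr -big_split; apply: eq_bigr => j _ /=.
  by rewrite !mxE mulrDl mulrA.
rewrite mulr_sumr -big_split; apply: eq_bigr => L _ /=.
rewrite !(eq_zero_sum_ext _ _ (pot L)) !zero_sum_ext_linear; ring.
Qed.

Lemma strand_of_line c L a b s : L \in Ls -> a \in L -> b \in L -> a != b ->
  strand_of c a b s = zero_sum_ext L (strand_pot c L) (a :: b :: s) -
                      zero_sum_ext L (strand_pot c L) (b :: a :: s).
Proof.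
move=> Ll aL bL ab; rewrite /strand_of (bigD1 L) //= big1 ?addr0 // => L' /andP[L'l nL].
have [aL'|aL'] := boolP (a \in L').
  have bL' : b \notin L'.
    by apply: contra nL => bL'; apply/eqP/(line_inj L'l Ll ab).
  by rewrite !(@zero_sum_ext_out _ _ L' _ _ b) ?subrr // !inE eqxx ?orbT.
by rewrite !(@zero_sum_ext_out _ _ L' _ _ a) ?subrr // !inE eqxx ?orbT.
Qed.

Lemma linear_strand_of c p : linear_strand p (strand_of c).
Proof.
split=> [a b s t st|a b s|a b d s _|L a s Ll aL _].
- apply: eq_bigr => L _.
  by congr (_ - _); apply: ext_pot_sym; rewrite perm_cons.
- by rewrite -sumrN; apply: eq_bigr => L _; rewrite opprB.
- rewrite -!big_split big1 // => L _ /=.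
  have e x y z : zero_sum_ext L (strand_pot c L) (x :: y :: z :: s) =
      zero_sum_ext L (strand_pot c L) (x :: z :: y :: s).
    by apply: ext_pot_sym; rewrite (perm_catCA [:: y] [:: z] s).
  rewrite (e a b d) (e b a d) (e b d a) (e d a b); ring.
rewrite exchange_big /= (bigD1 L) //= [X in _ + X]big1 ?addr0.
  by rewrite sumrB zero_sum_ext_sum1 zero_sum_ext_sum0 subrr.
move=> L' /andP[L'l nL]; apply: big1 => b bL.
have [->|ab] := eqVneq b a; first by rewrite subrr.
have [aL'|aL'] := boolP (a \in L').
  have bL' : b \notin L'.
    by apply: contra nL => bL'; apply/eqP/(line_inj L'l Ll ab).
  by rewrite !(@zero_sum_ext_out _ _ L' _ _ b) ?subrr // !inE eqxx ?orbT.
by rewrite !(@zero_sum_ext_out _ _ L' _ _ a) ?subrr // !inE eqxx ?orbT.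
Qed.

Lemma supported_strand_of c p : supported p (strand_of c).
Proof.
move=> L a b d s Ll aL bL ab ds dL _; rewrite (strand_of_line _ _ Ll) //.
by rewrite !(@zero_sum_ext_out _ _ L _ _ d) ?subrr // !inE ds ?orbT.
Qed.

(** The first term of the potential at (a, M, s) reads off the coefficient of j; the second one
    vanishes. *)
Lemma coord_strand_of c j : coord (strand_of c) (tval (enum_val j).2) = c 0 j.
Proof.
have := enum_valP j; rewrite inE; case e: (enum_val j) => [L x] /= /andP[Ll].
case ex: (tval x) => [|a [|b r]] //= /and3P[/and3P[aL bL rL] srt lt].
have rE := lastI b r; set s := belast b r in rE *; set M := last b r in rE lt *.
have all_br : all (mem (proper_part L)) (rcons s M) by rewrite -rE /= bL rL.
move: all_br; rewrite all_rcons /= => /andP[ML sL].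
have aM : a != M by apply: contraTneq lt => ->; rewrite ltnn.
rewrite (strand_of_line _ _ Ll) ?(proper_part_sub (L := L)) //.
rewrite !zero_sum_ext_id //=; last 2 first.
- by rewrite ML aL.
- by rewrite aL ML.
have srt' : sorted ordle (rcons s M) by rewrite -rE.
have eM : sort ordle (M :: s) = rcons s M.
  apply: (sorted_eq ordle_trans ordle_anti) => //; first exact: sort_sorted ordle_total _.
  by rewrite perm_sort -perm_rcons.
rewrite /strand_pot /= eM -rE (bigD1 j) //= e /= eqxx ex eqxx mulr1.
rewrite big1 ?addr0 => [|i nij]; last first.
  case: eqP => [e1|_]; rewrite ?mulr0 //=; case: eqP => [e2|_]; rewrite ?mulr0 //.
  case/eqP: nij; apply: enum_val_inj; rewrite e.
  by case: (enum_val i) e1 e2 => L1 x1 /= -> e2; congr (_, _); apply: val_inj; rewrite /= e2.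
(* The second term starts with M and has the tail a, s with entries at most M, which violates the
   strict inequality of [local_index]. *)
rewrite big1 ?subr0 // => i _; have := enum_valP i; rewrite inE => /andP[_].
case: eqP => [_|_ _]; rewrite ?mulr0 //=; case: eqP => [->|_]; rewrite ?mulr0 //=.
case es: (sort _ _) => [|b' r'] //= /and3P[_ srt2 lt2].
suff : (last b' r' <= M)%N by rewrite leqNgt lt2.
have : last b' r' \in a :: s.
  by rewrite -(mem_sort ordle) es mem_last.
rewrite inE => /predU1P[->|ls]; first exact: ltnW.
move: srt'; rewrite (sorted_pairwise ordle_trans) pairwise_rcons => /andP[/allP le_M _].
exact: le_M.
Qed.


(** The coordinates determine a supported strand: the relations express every value through those
    whose largest entry comes second and which avoid the base point. *)
Lemma strand_vanish w : linear_strand q w -> supported q w ->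
    (forall x, x \in strand_index -> coord w (tval x.2) = 0) ->
  forall a b s, size s = q -> w a b s = 0.
Proof.
move=> sw supw w0.
have wmax L a M s : L \in Ls -> a \in proper_part L -> M \in proper_part L ->
    all (mem (proper_part L)) s -> (a <= M)%N -> all (fun b : 'I_n => b <= M)%N s ->
    size s = q -> w a M s = 0.
  move=> Ll aL ML sL; rewrite leq_eqVlt => /predU1P[/val_inj->|aM] sM sq.
    exact: strand_diag sw.
  have szt : size (a :: rcons (sort ordle s) M) == q.+2.
    by rewrite /= size_rcons size_sort sq.
  have := w0 (L, Tuple szt); rewrite inE Ll /=.
  have -> : w a M s = w a M (sort ordle s).
    by apply: strand_sym sw _ _ _ _ _; rewrite perm_sym perm_sort.
  have all_sM : all (mem (proper_part L)) (rcons (sort ordle s) M).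
    by rewrite all_rcons /= ML all_sort.
  have sort_sM : sorted ordle (rcons (sort ordle s) M).
    rewrite (sorted_pairwise ordle_trans) pairwise_rcons all_sort sM /=.
    by rewrite -(sorted_pairwise ordle_trans) sort_sorted //; apply: ordle_total.
  case er: (rcons (sort ordle s) M) all_sM sort_sM => [|b r] all_sM sort_sM.
    by move/(congr1 size): er; rewrite size_rcons.
  have /rcons_inj[-> eM] : rcons (sort ordle s) M = rcons (belast b r) (last b r).
    by rewrite er lastI.
  rewrite -eM; apply; move: (all_sM) => /=; rewrite aL => -> /=.
  rewrite -[path _ _ _]/(sorted ordle (b :: r)).
  by rewrite sort_sM.
(* If the largest entry M lies in s, the cyclic identity moves it into the first two places, where
   [wmax] applies. *)
have wproper L a b s : L \in Ls -> a \in proper_part L -> b \in proper_part L ->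
    all (mem (proper_part L)) s -> size s = q -> w a b s = 0.
  move=> Ll aL bL sL sq.
  case: (@arg_maxnP _ a (mem [:: a, b & s]) (@nat_of_ord n)); first exact: mem_head.
  move=> M Min Mmax.
  have leM : all (fun b : 'I_n => b <= M)%N [:: a, b & s] by apply/allP => x /Mmax.
  have /= /and3P[aM bM sM] := leM.
  move: Min; rewrite !inE => /or3P[/eqP e|/eqP e|Ms].
  - by subst M; rewrite (strand_alt sw) (wmax L) ?oppr0.
  - by subst M; rewrite (wmax L).
  have tM := perm_to_rem Ms; rewrite (strand_sym sw a b tM).
  have szt : (size (rem M s)).+1 = q by rewrite (perm_size tM) /= in sq.
  have /= /andP[ML tL] : all (mem (proper_part L)) (M :: rem M s) by rewrite -(perm_all _ tM).
  have /= /andP[_ tleM] : all (fun b : 'I_n => b <= M)%N (M :: rem M s) by rewrite -(perm_all _ tM).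
  have := strand_cyc sw a b M szt.
  rewrite (strand_alt sw M a) (wmax L b M) ?(wmax L a M) ?oppr0 ?addr0 //=.
  - by rewrite bL.
  - by rewrite bM.
  - by rewrite aL.
  - by rewrite aM.
pose G s := if s is a :: b :: s' then w a b s' else 0.
(* The zero-sum condition holds in every slot: for slots inside s, the cyclic identity reduces it to
   the first two slots. *)
have Gsum L p t : L \in Ls -> all (mem L) p -> all (mem L) t ->
    size (p ++ t) = q.+1 -> \sum_(c in L) G (p ++ c :: t) = 0.
  move=> Ll; case: p => [|a [|b p]] /=.
  - case: t => [|b t] //= _ /andP[bL tL] [sq].
    under eq_bigr do rewrite (strand_alt sw) /=.
    by rewrite sumrN (strand_sum sw Ll) ?oppr0.
  - by move=> /andP[aL _] tL [sq]; rewrite (strand_sum sw Ll).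
  move=> /and3P[aL bL pL] tL [sq].
  have e c : w a b (p ++ c :: t) = - (w b c (a :: p ++ t) + w c a (b :: p ++ t)).
    apply/eqP; rewrite -addr_eq0 addrA -(strand_cyc sw a b c sq) -!addrA.
    have pc : perm_eq (p ++ c :: t) (c :: p ++ t) by rewrite (perm_catCA p [:: c] t).
    by rewrite (strand_sym sw a b pc).
  under eq_bigr do rewrite e (strand_alt sw _ a).
  by rewrite sumrN sumrB !(strand_sum sw Ll) ?subrr ?oppr0.
have Gproper L p : L \in Ls -> all (mem (proper_part L)) p -> size p = q.+2 -> G p = 0.
  move=> Ll; case: p => [|a [|b p]] //= /and3P[aL bL pL] [sq].
  exact: (wproper L).
(* Base points are removed one slot at a time: by the zero sum in that slot, the value at the base
   point is minus the sum of values at proper points. *)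
have Gline L t p : L \in Ls -> all (mem (proper_part L)) p -> all (mem L) t ->
    size (p ++ t) = q.+2 -> G (p ++ t) = 0.
  move=> Ll; elim: t p => [|a t IHt] p pL /=.
    by rewrite cats0 => _; apply: Gproper pL.
  case/andP=> aL tL; rewrite size_cat /= addnS => -[sq].
  have [c cL] := ex_base aL.
  have Gp b : b \in proper_part L -> G (p ++ b :: t) = 0.
    move=> bL; rewrite -cat_rcons; apply: IHt => //; last first.
      by rewrite size_cat size_rcons addSn sq.
    by rewrite all_rcons /= bL.
  have [->|ac] := eqVneq a c; last by apply: Gp; rewrite (proper_partP _ cL) aL.
  have := Gsum L p t Ll; rewrite size_cat (bigD1 c) ?is_base_in //= big1 ?addr0.
    apply=> //; apply: sub_all pL => x; exact: proper_part_sub.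
  by move=> b /andP[bL bc]; apply: Gp; rewrite (proper_partP _ cL) bL.
move=> a b s sq; have [->|ab] := eqVneq a b; first exact: strand_diag sw.
have [L [Ll aL bL]] := line_ex ab.
have [sL|/allPn[c cs cL]] := boolP (all (mem L) s); last first.
  exact: supw Ll aL bL ab cs cL sq.
by apply: (Gline L [:: a, b & s] [::] Ll); rewrite //= ?aL ?bL ?sq.
Qed.

(** Subtracting from w the strand with the same coordinates leaves a supported strand with zero
    coordinates. *)
Lemma strand_ofP w : linear_strand q w -> supported q w ->
  exists c, forall a b s, size s = q -> w a b s = strand_of c a b s.
Proof.
move=> sw supw; pose c : 'rV_#|strand_index| := \row_j coord w (tval (enum_val j).2).
exists c => a b s sq; apply/eqP; rewrite -subr_eq0; apply/eqP.
apply: (@strand_vanish (fun a b s => w a b s - strand_of c a b s)) sq => {a b s}.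
- split=> [a b s t st|a b s|a b d s sq|L a s Ll aL sq].
  + by rewrite (strand_sym sw a b st) (strand_sym (linear_strand_of c q) a b st).
  + by rewrite (strand_alt sw a b) (strand_alt (linear_strand_of c q) a b) opprB opprK addrC.
  + have := strand_cyc sw a b d sq; have := strand_cyc (linear_strand_of c q) a b d sq.
    by move=> e1 e2; rewrite -(subrr 0) -{1}e2 -e1; ring.
  by rewrite sumrB (strand_sum sw Ll) // (strand_sum (linear_strand_of c q) Ll) // subrr.
- move=> L a b d s Ll aL bL ab ds dL sq.
  by rewrite (supw L a b d) // (@supported_strand_of c q L a b d) // subrr.
move=> x xI; have := coord_strand_of c (enum_rank_in xI x).
rewrite mxE enum_rankK_in //; rewrite /coord.
by case: (tval x.2) => [|a [|b r]] // ->; rewrite subrr.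
Qed.

Lemma strand_of_inj c : (forall a b s, size s = q -> strand_of c a b s = 0) -> c = 0.
Proof.
move=> c0; apply/rowP => j; rewrite mxE -coord_strand_of.
case e: (tval _) (size_tuple (enum_val j).2) => [|a [|b r]] //= [sq].
by apply: c0; rewrite size_belast.
Qed.

End Degree.
End LinearStrand.

(** * Counting the coordinates *)

Section Counting.
Local Open Scope nat_scope.
Variable n : nat.
Implicit Types (Y L : {set 'I_n}).

(** The increasing enumeration of Y transports the count of sorted tuples over an initial
    segment. *)
Lemma card_sorted_in Y r :
  #|[set t : r.+1.-tuple 'I_n | all (mem Y) t && sorted (@ordle n) t]| = 'C(#|Y| + r, r.+1).
Proof.
have [Y0|[x0 Yx0]] := set_0Vmem Y.
  rewrite Y0 cards0 bin_small //; apply/eqP; rewrite cards_eq0; apply/eqP/setP=> t.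
  by rewrite !inE; case: t => -[|a t] //= _; rewrite inE.
case cY: #|Y| => [|m]; first by rewrite (cardsD1 x0) Yx0 in cY.
pose f (i : 'I_m.+1) : 'I_n := Order.enum_val (cast_ord (esym cY) i).
have f_inj : injective f by move=> i j /Order.EnumVal.enum_val_inj/cast_ord_inj.
have f_mono (i j : 'I_m.+1) : ordle (f i) (f j) = (i <= j)%N.
  exact: (Order.EnumVal.le_enum_val (@ordle_total n) (cast_ord (esym cY) i) (cast_ord (esym cY) j)).
have f_onto x : x \in Y -> exists i, f i = x.
  move=> Yx; exists (cast_ord cY (Order.EnumVal.enum_rank_in Yx x)).
  by rewrite /f cast_ordK Order.EnumVal.enum_rankK_in.
have -> : [set t : r.+1.-tuple 'I_n | all (mem Y) t && sorted (@ordle n) t] =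
    [set map_tuple f u | u in [set u : r.+1.-tuple 'I_m.+1 | sorted leq (map val u)]].
  apply/setP=> t; rewrite inE; apply/andP/imsetP => [[/allP tY st]|[u]].
    have /fin_all_exists[g gP] : forall i, exists j, f j = tnth t i.
      by move=> i; apply/f_onto/tY/mem_tnth.
    exists [tuple g i | i < r.+1]; last first.
      by apply: eq_from_tnth => i; rewrite tnth_map tnth_mktuple gP.
    rewrite inE sorted_map -(@eq_sorted _ (relpre f (@ordle n))) => [|i j].
      rewrite -sorted_map (_ : map f _ = t) //.
      by rewrite -map_comp -[RHS](map_tnth_enum t); apply: eq_map => i /=.
    exact: f_mono.
  rewrite inE sorted_map => su ->; split.
    by apply/allP => x /mapP[i _ ->]; apply: Order.EnumVal.enum_valP.
  rewrite sorted_map (@eq_sorted _ _ (relpre val leq)) // => i j; exact: f_mono.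
rewrite card_imset ?card_sorted_tuples; first by rewrite addnC addSnnS.
by move=> u v /(congr1 val) /(inj_map f_inj) /val_inj.
Qed.

(** Among the tuples P with free head and sorted tail, those with head at least the last entry
    become sorted once the head is moved to the end. Their number is subtracted from that of P. *)
Lemma card_local_index q Y :
  #|[set t : q.+2.-tuple 'I_n | local_index Y t]| = q.+1 * 'C(#|Y| + q, q.+2).
Proof.
pose S r := [set t : r.+1.-tuple 'I_n | all (mem Y) t && sorted (@ordle n) t].
pose P := [set t : q.+2.-tuple 'I_n | all (mem Y) t && sorted (@ordle n) (behead t)].
have cP : #|P| = #|Y| * 'C(#|Y| + q, q.+1).
  rewrite -card_sorted_in -/(S q) -cardsX.
  rewrite -(@card_imset _ _ (fun p : 'I_n * q.+1.-tuple 'I_n => cons_tuple p.1 p.2)).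
    congr #|pred_of_set _|; apply/setP=> t; apply/idP/imsetP => [|[[a u]]].
      case/tupleP: t => a u; rewrite inE /= => /andP[/andP[aY uY] su].
      by exists (a, u); [rewrite in_setX /= aY inE uY su | apply: val_inj].
    by rewrite in_setX => /andP[/= aY]; rewrite inE => /andP[uY su] ->; rewrite inE /= aY uY.
  by move=> [a u] [b v] /(congr1 val) /= [-> /val_inj ->].
pose Q := [set t : q.+2.-tuple 'I_n | t \in P & ~~ local_index Y t].
have cQ : #|Q| = 'C(#|Y| + q.+1, q.+2).
  rewrite -card_sorted_in -/(S q.+1).
  pose h (t : q.+2.-tuple 'I_n) := [tuple of rcons (behead_tuple t) (thead t)].
  have h_inj : injective h.
    case/tupleP=> a u; case/tupleP=> b v /(congr1 val) /= /rcons_inj[].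
    by move=> /= uv; rewrite !theadE => ->; apply: val_inj; rewrite /= uv.
  rewrite -(card_imset _ h_inj); congr #|pred_of_set _|; apply/setP=> t.
  apply/imsetP/idP => [[u uQ ->]|].
    move: uQ; rewrite !inE; case/tupleP: u => a; case/tupleP=> b u.
    rewrite /= theadE => /andP[/andP[/and3P[aY bY uY] su]].
    rewrite aY bY uY su /= -leqNgt => la.
    rewrite all_rcons /= aY uY -[path _ _ _]/(sorted _ (rcons (b :: u) a)).
    rewrite (sorted_pairwise (@ordle_trans n)) pairwise_rcons.
    move: (su); rewrite -[path _ _ _]/(sorted _ (b :: u)).
    rewrite (sorted_pairwise (@ordle_trans n)) => ->; rewrite andTb andbT.
    apply/allP => x xu; apply: leq_trans la.
    move: su; rewrite -[path _ _ _]/(sorted _ (b :: u)) (lastI b u).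
    rewrite (sorted_pairwise (@ordle_trans n)) pairwise_rcons => /andP[/allP lu _].
    by move: xu; rewrite lastI mem_rcons inE => /predU1P[->|/lu].
  case: t => t tsz; case/lastP: t tsz => // u M tsz.
  have usz : size u == q.+1 by move: tsz; rewrite size_rcons.
  rewrite inE /= all_rcons /= (sorted_pairwise (@ordle_trans n)) pairwise_rcons.
  rewrite -(sorted_pairwise (@ordle_trans n)) => /and3P[/andP[MY uY] /allP uM su].
  have e : Tuple tsz = h (cons_tuple M (Tuple usz)) by apply: val_inj.
  exists (cons_tuple M (Tuple usz)) => //; rewrite !inE /=.
  case: u usz {tsz e} uY uM su => [|b u] // _ uY uM su.
  rewrite uY su MY -[path _ _ _]/(sorted _ (b :: u)) su !andTb -leqNgt.
  by apply: uM; rewrite mem_last.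
apply/eqP; rewrite -(eqn_add2r #|Q|) cQ.
have -> : #|[set t : q.+2.-tuple 'I_n | local_index Y t]| + 'C(#|Y| + q.+1, q.+2) = #|P|.
  rewrite -cQ; have -> : Q = P :\: [set t : q.+2.-tuple 'I_n | local_index Y t].
    by apply/setP=> t; rewrite !inE andbC.
  rewrite -(cardsID [set t : q.+2.-tuple 'I_n | local_index Y t] P); congr (#|pred_of_set _| + _).
  apply/setP=> t; rewrite !inE; case: t => -[|a [|b u]] //= _.
  by rewrite -!andbA; case: (a \in Y); case: (b \in Y); case: all; case: path.
rewrite cP addnS binS; case: #|Y| => [|m].
  by rewrite add0n !bin_small ?muln0.
have := mul_bin_left (m.+1 + q) q.+1.
set x := 'C(_, q.+1); set y := 'C(_, q.+2) => e; apply/eqP.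
have {}e : q.+2 * y = m * x by rewrite e addSn subSS addnK.
nia.
Qed.

Lemma card_strand_index (Ls : {set {set 'I_n}}) q :
  #|strand_index Ls q| = q.+1 * \sum_(L in Ls) 'C(#|L|.-1 + q, q.+2).
Proof.
rewrite big_distrr /= -sum1_card (eq_bigl (fun x : {set 'I_n} * q.+2.-tuple 'I_n =>
  (x.1 \in Ls) && local_index (proper_part x.1) x.2)) => [|x]; last by rewrite inE.
rewrite -(pair_big_dep (mem Ls)
  (fun L (t : q.+2.-tuple 'I_n) => local_index (proper_part L) t) (fun _ _ => 1%N)) /=.
apply: eq_bigr => L _; rewrite -card_proper_part -card_local_index -sum1_card.
by apply: eq_bigl => t; rewrite inE.
Qed.

End Counting.

(** * Quadratic elements of the exterior algebra *)

Section QuadraticPart.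
Variables (k : fieldType) (n : nat).
Hypothesis char0 : [pchar k] =i pred0.
Local Notation E := (exterior k n).
Implicit Types (x y : E) (a b c : 'I_n) (S U : {set 'I_n}).

Lemma contract0 a x : contract a x set0 = x [set a].
Proof.
rewrite contractE inE setU0 (_ : [set j in set0 | _] = set0) ?cards0 ?mul1r //.
by apply/setP=> j; rewrite !inE.
Qed.

Lemma contract_anticomm a b x : contract a (contract b x) = - contract b (contract a x).
Proof.
wlog ab : a b / (a <= b)%N.
  move=> W; have [/W//|/ltnW/W e] := leqP a b.
  by apply/eqP; rewrite -eqr_oppLR; apply/eqP.
apply: exteriorP => S; rewrite extN !contractE !inE.
have [eab|nab] := eqVneq a b.
  by rewrite !mulr0 !if_same oppr0.
rewrite !orFb; case: ifPn => aS; case: ifPn => bS; rewrite ?mulr0 ?oppr0 //.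
rewrite setUCA !mulrA -!exprD -mulNr; congr (_ * _).
have lt : (a < b)%N by rewrite ltn_neqAle ab andbT.
have -> : [set j in a |: S | (j < b)%N] = a |: [set j in S | (j < b)%N].
  by apply/setP=> j; rewrite !inE; case: eqP => [->|] //=; rewrite lt.
have -> : [set j in b |: S | (j < a)%N] = [set j in S | (j < a)%N].
  by apply/setP=> j; rewrite !inE; case: eqP => [->|] //=; rewrite ltnNge ab andbF.
by rewrite cardsU1 inE (negPf aS) /= addnCA add1n exprS mulN1r addnC.
Qed.

(** The antisymmetric coefficient matrix of the degree 2 part of x. *)
Definition coef2 x a b : k := contract b (contract a x) set0.

Lemma coef2_anti x a b : coef2 x a b = - coef2 x b a.
Proof. by rewrite /coef2 contract_anticomm extN. Qed.

Lemma coef2_diag x a : coef2 x a a = 0.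
Proof. exact: (eq_opp_eq0 char0 (coef2_anti x a a)). Qed.

Lemma coef2E x a b : coef2 x a b =
  if a == b then 0 else (-1) ^+ (b < a)%N * x [set a; b].
Proof.
rewrite /coef2 contract0 contractE inE; case: eqP => // _; congr (_ ^+ _ * _).
rewrite (_ : [set j in [set b] | _] = if (b < a)%N then [set b] else set0).
  by case: ifP; rewrite ?cards1 ?cards0.
apply/setP=> j; rewrite !inE; have [->|nj] := eqVneq j b.
  by case: ifP; rewrite !inE ?eqxx.
by case: ifP; rewrite !inE ?(negPf nj).
Qed.

Lemma coef2_linear a b : linear (fun x => coef2 x a b : k^o).
Proof. by move=> c x y; rewrite /coef2 !linearP extD extZ. Qed.

Lemma coef2_gen2 c d a b : coef2 (ext_gen k c * ext_gen k d) a b =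
  (a == c)%:R * (b == d)%:R - (a == d)%:R * (b == c)%:R.
Proof.
have gen0 e f : contract e (ext_gen k f) = (e == f)%:R *: 1.
  rewrite -[ext_gen k f]mulr1 contract_gen (_ : contract e 1 = 0) ?mulr0 ?subr0 //.
  apply: exteriorP => S; rewrite contractE ext0; case: ifP => // eS.
  rewrite ffunE; case: eqP => [e0|]; rewrite ?mulr0 //.
  by have := setU11 e S; rewrite e0 inE.
rewrite /coef2 contract_gen gen0 -scalerAr mulr1 linearB !linearZ /= !gen0 !scalerA.
by rewrite extD !extZ extN extZ ffunE eqxx !mulr1 mulrN.
Qed.

Lemma gen2_pure a b (S : {set 'I_n}) : #|S| != 2%N -> (ext_gen k a * ext_gen k b) S = 0.
Proof.
move=> ne; rewrite ext_genME; case: ifPn => // aS; rewrite ffunE.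
have [e|_] := eqVneq (S :\ a) [set b]; last by rewrite mulr0.
by rewrite (cardsD1 a) aS e cards1 in ne.
Qed.

Definition pure_degree d x := forall S, #|S| != d -> x S = 0.

Lemma pure_degree_contract d a x : pure_degree d.+1 x -> pure_degree d (contract a x).
Proof.
move=> hx S ne; rewrite contractE; case: ifPn => // aS.
by rewrite hx ?mulr0 // cardsU1 aS.
Qed.

Lemma contract_eq0 d x : pure_degree d.+1 x -> (forall a, contract a x = 0) -> x = 0.
Proof.
move=> hx x0; apply: exteriorP => S; rewrite ext0.
have [cS|/hx//] := eqVneq #|S| d.+1.
have /card_gt0P[a aS] : (0 < #|S|)%N by rewrite cS.
have := congr1 (fun y : E => y (S :\ a)) (x0 a); rewrite /= contractE setD11 setD1K //.
by rewrite ext0 => /eqP; rewrite mulf_eq0 signr_eq0 => /eqP.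
Qed.

Lemma pure_degree1_sum x : pure_degree 1%N x -> x = \sum_b x [set b] *: ext_gen k b.
Proof.
move=> hx; apply: exteriorP => S; rewrite ext_sum.
have [/eqP/cards1P[c ->]|ne] := eqVneq #|S| 1%N.
  rewrite (bigD1 c) //= big1 ?addr0 => [|b bc]; rewrite extZ ffunE ?eqxx ?mulr1 //.
  by rewrite (inj_eq set1_inj) eq_sym (negPf bc) mulr0.
rewrite hx // big1 // => b _; rewrite extZ ffunE; case: eqP => [e|]; rewrite ?mulr0 //.
by rewrite e cards1 in ne.
Qed.

Lemma pure_degree2_sum x : pure_degree 2%N x ->
  2%:R *: x = \sum_a \sum_b coef2 x a b *: (ext_gen k a * ext_gen k b).
Proof.
move=> hx; have -> : 2%:R *: x = \sum_a ext_gen k a * contract a x.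
  apply: exteriorP => S; rewrite extZ gen_contract_sum.
  by have [->//|/hx->] := eqVneq #|S| 2%N; rewrite !mulr0.
apply: eq_bigr => a _; rewrite {1}(pure_degree1_sum (pure_degree_contract a hx)) mulr_sumr.
by apply: eq_bigr => b _; rewrite -scalerAr /coef2 contract0.
Qed.

Lemma coef2_ext x y : pure_degree 2%N x -> pure_degree 2%N y ->
  (forall a b, coef2 x a b = coef2 y a b) -> x = y.
Proof.
move=> hx hy xy; have n2 := natr_neq0 char0 (isT : 0 < 2)%N.
apply: (scalerI n2); rewrite !pure_degree2_sum //.
by do 2!apply: eq_bigr => ? _; rewrite xy.
Qed.

(** Three contractions extract a cubic coefficient, so the vanishing of the Koszul differential on
    quadratic families becomes the cyclic identity. *)
Lemma contract3_koszul (u : seq 'I_n -> E) s a b c :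
  contract a (contract b (contract c (\sum_d ext_gen k d * u (d :: s)))) set0 =
  - (coef2 (u (c :: s)) a b + coef2 (u (a :: s)) b c + coef2 (u (b :: s)) c a).
Proof.
have step e (v : 'I_n -> E) : contract e (\sum_d ext_gen k d * v d) =
    v e - \sum_d ext_gen k d * contract e (v d).
  rewrite linear_sum /=; under eq_bigr do rewrite contract_gen.
  rewrite sumrB; congr (_ - _); rewrite (bigD1 e) //= eqxx scale1r big1 ?addr0 // => d de.
  by rewrite eq_sym (negPf de) scale0r.
rewrite step !linearB /= step !linearB /= step !(extD, extN) ext_sum big1 => [|d _]; last first.
  by rewrite ext_genME inE.
rewrite -/(coef2 _ b a) -/(coef2 _ c b) -/(coef2 _ c a).
rewrite (coef2_anti _ b a) (coef2_anti _ c b); ring.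
Qed.

Lemma koszul2_eq0 (u : seq 'I_n -> E) s : (forall d, pure_degree 2%N (u (d :: s))) ->
  (forall a b c, coef2 (u (c :: s)) a b + coef2 (u (a :: s)) b c + coef2 (u (b :: s)) c a = 0) ->
  \sum_d ext_gen k d * u (d :: s) = 0.
Proof.
move=> hu cyc; set x := \sum_d _.
have hx : pure_degree 3%N x.
  move=> S ne; rewrite ext_sum big1 // => d _; rewrite ext_genME; case: ifPn => // dS.
  by rewrite hu ?mulr0 //; apply: contra ne; rewrite (cardsD1 d S) dS.
apply: (contract_eq0 hx) => c; apply: (contract_eq0 (pure_degree_contract c hx)) => b.
have hbc := pure_degree_contract b (pure_degree_contract c hx).
apply: (contract_eq0 hbc) => a; apply: exteriorP => S; rewrite ext0.
have [/eqP|/(pure_degree_contract a hbc)//] := eqVneq #|S| 0%N.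
by rewrite cards_eq0 => /eqP->; rewrite contract3_koszul cyc oppr0.
Qed.

(** On the lowest possible degree of y, only the constant term of x contributes. *)
Lemma ext_mul_low d x y S : (forall U, (#|U| < d)%N -> y U = 0) -> (#|S| <= d)%N ->
  (x * y) S = x set0 * y S /\ (y * x) S = y S * x set0.
Proof.
move=> y0 Sd; split; rewrite ffunE.
  rewrite (bigD1 set0) ?sub0set //= big1 ?addr0 => [|U /andP[sUS nU]].
    by rewrite setD0 /inversions big_set0 mul1r.
  rewrite y0 ?mulr0 //; apply: leq_trans Sd; rewrite cardsDS //.
  rewrite ltn_subrL !card_gt0 nU /=; apply: contraNneq nU => e.
  by rewrite -subset0 -e.
rewrite (bigD1 S) //= big1 ?addr0 => [|U /andP[sUS nU]].
  rewrite setDv /inversions big1 ?mul1r // => i _; exact: big_set0.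
rewrite y0 ?mul0r ?mulr0 //; apply: leq_trans Sd; apply: proper_card.
by rewrite properEneq nU.
Qed.

Lemma gen3_basis p a b : exists c : k,
  ext_gen k p * (ext_gen k a * ext_gen k b) = c *: ext_basis k [set p; a; b] /\
  (c != 0 -> #|[set p; a; b]| = 3%N).
Proof.
set x := _ * _; have x0 U : x U != 0 -> U = [set p; a; b] /\ #|U| = 3%N.
  rewrite /x ext_genME; case: ifPn => pU; last by rewrite eqxx.
  rewrite ext_genME; case: ifPn => aU; last by rewrite mulr0 eqxx.
  rewrite ffunE; have [e|_] := eqVneq (U :\ p :\ a) [set b]; last by rewrite !mulr0 eqxx.
  move=> _; split; first by rewrite -(setD1K pU) -(setD1K aU) e setUA.
  by rewrite (cardsD1 p) pU (cardsD1 a) aU e cards1.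
exists (x [set p; a; b]); split; last by case/x0.
apply: exteriorP => U; rewrite extZ [ext_basis _ _ _]ffunE; have [->|ne] := eqVneq U [set p; a; b].
  by rewrite mulr1.
by rewrite mulr0; apply/eqP; apply: contraNT ne => /x0[->].
Qed.

Lemma ext_diff_basis_pure (J : {set 'I_n}) : pure_degree #|J|.-1 (ext_diff (ext_basis k J)).
Proof.
move=> S ne; rewrite ffunE big1 // => i iS; rewrite ffunE; case: eqP => [e|]; rewrite ?mulr0 //.
by rewrite -e cardsU1 iS eqxx in ne.
Qed.

End QuadraticPart.

(** * The degree two part of the Orlik-Solomon ideal *)

Section Lines.
Variables (K : fieldType) (l n : nat) (H : 'I_n -> {vspace 'rV[K]_l}).
Hypothesis arrH : central_arrangement H.
Implicit Types (X : {vspace 'rV[K]_l}) (J L : {set 'I_n}).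

Definition above X : {set 'I_n} := [set i | (X <= H i)%VS].
Definition lines : {set {set 'I_n}} := [set:: [seq above X | X <- rank2_flats H]].

Lemma dim_le X : (\dim X <= l)%N.
Proof. by have := dimvS (subvf X); rewrite dim_fullv. Qed.

Lemma flat2E a b : flat H [set a; b] = (H a :&: H b)%VS.
Proof.
have [->|ab] := eqVneq a b; first by rewrite setUid /flat big_set1 capvv.
by rewrite /flat big_setU1 ?inE // big_set1.
Qed.

(** The sum of two distinct hyperplanes strictly contains each, so it is the whole space, and the
    dimension formula gives the codimension. *)
Lemma codim_flat2 a b : a != b -> codim (flat H [set a; b]) = 2%N.
Proof.
move=> ab; rewrite flat2E; have [Hinj Hc] := arrH.
have := dimv_sum_cap (H a) (H b); have := Hc a; have := Hc b; rewrite /codim.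
have := dim_le (H a + H b); have : (\dim (H a) < \dim (H a + H b))%N.
  rewrite ltnNge; apply: contra ab => le.
  have e : (H a == H a + H b)%VS by rewrite eqEdim addvSl.
  apply/eqP/Hinj/esym/codim_inj; first by rewrite (eqP e) addvSr.
  by rewrite !Hc.
have := dim_le (H a); have := dim_le (H b).
lia.
Qed.

Lemma mem_rank2 J : codim (flat H J) = 2%N -> flat H J \in rank2_flats H.
Proof. by move=> e; rewrite mem_filter e eqxx flat_in. Qed.

Lemma flatS J a : a \in J -> (flat H J <= H a)%VS.
Proof. by move=> aJ; rewrite /flat (bigD1 a) //= capvSl. Qed.

Lemma flat_sub X J : J \subset above X -> (X <= flat H J)%VS.
Proof.
move=> /subsetP JX; apply/subv_bigcapP => i /JX; by rewrite inE.
Qed.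

Lemma rank2_codim X : X \in rank2_flats H -> codim X = 2%N.
Proof. by rewrite mem_filter => /andP[/eqP e _]; exact: e. Qed.

Lemma rank2_flat2 X a b : X \in rank2_flats H -> a != b ->
  a \in above X -> b \in above X -> X = flat H [set a; b].
Proof.
move=> /rank2_codim cX ab aX bX; apply: codim_inj.
  by apply: flat_sub; apply/subsetP => i /set2P[]->.
by rewrite codim_flat2.
Qed.

Lemma linesP L : reflect (exists2 X, X \in rank2_flats H & L = above X) (L \in lines).
Proof. by rewrite inE; exact: mapP. Qed.

Lemma line_ex a b : a != b -> exists L, [/\ L \in lines, a \in L & b \in L].
Proof.
move=> ab; exists (above (flat H [set a; b])); split.
- by apply/linesP; exists (flat H [set a; b]); rewrite ?mem_rank2 ?codim_flat2.
- by rewrite inE flatS ?set21.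
- by rewrite inE flatS ?set22.
Qed.

Lemma line_inj L L' a b : L \in lines -> L' \in lines -> a != b ->
  a \in L -> b \in L -> a \in L' -> b \in L' -> L = L'.
Proof.
move=> /linesP[X X2 ->] /linesP[X' X2' ->] ab aX bX aX' bX'.
by rewrite (rank2_flat2 X2 ab) // (rank2_flat2 X2' ab).
Qed.

(** A flat is recovered as the intersection of the hyperplanes above it. Hence sums over rank 2
    flats may be indexed by [lines]. *)
Lemma above_inj : {in rank2_flats H &, injective above}.
Proof.
have flatK X : X \in rank2_flats H -> flat H (above X) = X.
  rewrite mem_filter mem_undup => /andP[_ /mapP[J _ e]]; apply: subv_anti.
  rewrite flat_sub // andbT {2}e; apply/subv_bigcapP => i iJ.
  by apply: flatS; rewrite inE e flatS.
by move=> X Y XX YY e; rewrite -(flatK X) // e flatK.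
Qed.

Lemma sum_lines (f : {set 'I_n} -> nat) :
  (\sum_(L in lines) f L = \sum_(X <- rank2_flats H) f (above X))%N.
Proof.
rewrite -(big_map above xpredT f) big_uniq /=; last first.
  by rewrite map_inj_in_uniq ?filter_uniq ?undup_uniq //; exact: above_inj.
by apply: eq_bigl => L; rewrite inE.
Qed.

Lemma dependent_card J : dependent H J -> (2 < #|J|)%N.
Proof.
rewrite /dependent; case cJ: #|J| => [|[|[|m]]] //.
  by rewrite ltnS leqn0 => /eqP e; move/eqP: cJ => /cards1P[i eJ];
     rewrite eJ /flat big_set1 arrH.2 in e.
by move/eqP: cJ => /cards2P[a [b [ab ->]]]; rewrite codim_flat2.
Qed.

Lemma dependent3_line J : dependent H J -> #|J| = 3%N ->
  exists2 L, L \in lines & J \subset L.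
Proof.
rewrite /dependent => dJ cJ; rewrite cJ ltnS in dJ.
have [a [b [ab aJ bJ]]] : exists a b, [/\ a != b, a \in J & b \in J].
  have /card_gt1P[a [b [aJ bJ ab]]] : (1 < #|J|)%N by rewrite cJ.
  by exists a, b.
have e : codim (flat H J) = 2%N.
  apply/eqP; rewrite eqn_leq dJ -(codim_flat2 ab) codimS // flat2E subv_cap.
  by rewrite !flatS.
exists (above (flat H J)); first by apply/linesP; exists (flat H J); rewrite ?mem_rank2.
by apply/subsetP => i iJ; rewrite inE flatS.
Qed.

Lemma line_dependent L J : L \in lines -> J \subset L -> #|J| = 3%N -> dependent H J.
Proof.
case/linesP => X /rank2_codim cX -> JX cJ.
by rewrite /dependent cJ ltnS -cX codimS // flat_sub.
Qed.

(** * The degree 2 part of the ideal as the common kernel of the line sums *)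

Section Ideal.
Variable k : fieldType.
Hypothesis char0 : [pchar k] =i pred0.
Local Notation E := (exterior k n).
Local Notation I := (os_ideal k H).

(** The ideal is a product of subspaces; containment in the kernel of P is checked factor by factor
    down to the spanning family. *)
Lemma os_ideal_ind (P : E -> k^o) : linear P ->
  (forall y z J, dependent H J -> P (y * ext_diff (ext_basis k J) * z) = 0) ->
  forall x, x \in I -> P x = 0.
Proof.
move=> linP P0 x xI.
pose f : {linear E -> k^o} :=
  HB.pack P (GRing.isLinear.Build k E k^o *:%R P linP).
suff /subvP/(_ x xI) : (I <= lker (linfun f))%VS by rewrite memv_ker lfunE => /eqP.
apply/prodvP => u z uI _; rewrite memv_ker.
suff /subvP/(_ u uI) : (fullv * <<os_generators k H>> <= lker (linfun f \o amulr z))%VS.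
  by rewrite memv_ker comp_lfunE [amulr _ _]lfunE.
apply/prodvP => y g _ gI; rewrite memv_ker.
suff /subvP/(_ g gI) : (<<os_generators k H>> <= lker (linfun f \o amulr z \o amull y))%VS.
  by rewrite memv_ker !comp_lfunE [amull _ _]lfunE.
apply/span_subvP => v /mapP[J]; rewrite mem_filter => /andP[dJ _] ->.
by rewrite memv_ker !comp_lfunE [amull _ _]lfunE [amulr _ _]lfunE lfunE /= P0.
Qed.

Lemma ext_diff_basis_low J (S : {set 'I_n}) : dependent H J -> (#|S| < 2)%N ->
  ext_diff (ext_basis k J) S = 0.
Proof.
move=> /dependent_card J3 S2; apply: ext_diff_basis_pure.
by rewrite neq_ltn; apply/orP; left; apply: leq_trans S2 _; case: #|J| J3.
Qed.

Lemma ext_sandwich_low d (y g z : E) (S : {set 'I_n}) :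
  (forall U : {set 'I_n}, (#|U| < d)%N -> g U = 0) -> (#|S| <= d)%N ->
  (y * g * z) S = y set0 * z set0 * g S.
Proof.
move=> g0 Sd; have yg0 (U : {set 'I_n}) : (#|U| < d)%N -> (y * g) U = 0.
  by move=> Ud; rewrite (ext_mul_low y g0 (ltnW Ud)).1 g0 ?mulr0.
rewrite (ext_mul_low z yg0 Sd).2 (ext_mul_low y g0 Sd).1; exact: mulrAC.
Qed.

Lemma os_ideal_low x (S : {set 'I_n}) : x \in I -> (#|S| < 2)%N -> x S = 0.
Proof.
move=> xI S2; apply: (os_ideal_ind (P := fun y : E => y S)) xI => [c y z|y z J dJ].
  by rewrite extD extZ.
have g0 (U : {set 'I_n}) : (#|U| < 2)%N -> ext_diff (ext_basis k J) U = 0.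
  exact: ext_diff_basis_low.
by rewrite (ext_sandwich_low y z g0 (ltnW S2)) g0 ?mulr0.
Qed.

(** Only triples J contribute in degree 2. If J lies on another line, it shares at most one element
    with L; if it lies on L, the sum runs over a term antisymmetric in the removed index i and in
    b. *)
Lemma ext_diff_basis_line_sum J L a : dependent H J -> L \in lines -> a \in L ->
  \sum_(b in L) coef2 (ext_diff (ext_basis k J)) a b = 0.
Proof.
move=> dJ Ll aL; have [J3|nJ3] := eqVneq #|J| 3%N; last first.
  rewrite big1 // => b _; rewrite coef2E; case: eqP => // /eqP ab.
  rewrite ext_diff_basis_pure ?mulr0 // cards2 ab.
  by have := dependent_card dJ; case: #|J| nJ3 => [|[|[|[|]]]].
pose t i a b := contract b (contract a (contract i (ext_basis k J))) set0.
have tJ i a' b : t i a' b != 0 -> [/\ i \in J, a' \in J, b \in J & a' != b].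
  rewrite /t contract0 contractE; case: ifPn; rewrite ?eqxx // => a'b.
  rewrite contractE; case: ifPn; rewrite ?mulr0 ?eqxx // => i_ab.
  rewrite ffunE; have [<-|] := eqVneq _ J; last by rewrite !mulr0 eqxx.
  by rewrite !inE !eqxx ?orbT in a'b *.
have E_t b : coef2 (ext_diff (ext_basis k J)) a b = \sum_i t i a b.
  by rewrite /coef2 ext_diff_contract !linear_sum ext_sum.
have t_anti i b : t i a b = - t b a i.
  rewrite /t (contract_anticomm b a) (contract_anticomm b i) linearN /= opprK.
  by rewrite (contract_anticomm a i) extN.
under eq_bigr do rewrite E_t.
have [L' L'l /subsetP JL'] := dependent3_line dJ J3.
have [eL|nL] := eqVneq L' L; last first.
  rewrite big1 // => b bL; rewrite big1 // => i _; apply/eqP; apply: contraNT nL.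
  by case/tJ => _ aJ bJ ab; apply/eqP/(line_inj L'l Ll ab) => //; apply: JL'.
rewrite (eq_bigr (fun b => \sum_(i in L) t i a b)) => [|b _]; last first.
  rewrite [LHS](bigID (mem L)) /= [X in _ + X]big1 ?addr0 // => i iL.
  by apply/eqP; apply: contraNT iL => /tJ[iJ _ _ _]; rewrite -eL JL'.
apply: (eq_opp_eq0 char0); rewrite -sumrN [LHS]exchange_big; apply: eq_bigr => b _ /=.
by rewrite -sumrN; apply: eq_bigr => i _; rewrite t_anti.
Qed.

Lemma os_ideal_line_sum x L a : x \in I -> L \in lines -> a \in L ->
  \sum_(b in L) coef2 x a b = 0.
Proof.
move=> xI Ll aL.
apply: (os_ideal_ind (P := fun y : E => \sum_(b in L) coef2 y a b)) xI => [c y z|y z J dJ].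
  rewrite scaler_sumr -big_split; apply: eq_bigr => b _; exact: coef2_linear.
have g0 (U : {set 'I_n}) : (#|U| < 2)%N -> ext_diff (ext_basis k J) U = 0.
  exact: ext_diff_basis_low.
have e b : coef2 (y * ext_diff (ext_basis k J) * z) a b =
    y set0 * z set0 * coef2 (ext_diff (ext_basis k J)) a b.
  rewrite !coef2E; case: eqP => [_|/eqP ab]; first by rewrite mulr0.
  by rewrite (ext_sandwich_low y z g0) ?cards2 ?ab // mulrCA.
by under eq_bigr do rewrite e; rewrite -mulr_sumr ext_diff_basis_line_sum ?mulr0.
Qed.

Lemma ext_diff_gen2 (a b : 'I_n) : ext_diff (ext_gen k a * ext_gen k b) = ext_gen k b - ext_gen k a.
Proof. by rewrite ext_diff_genM ext_diff_gen mulr1. Qed.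

Lemma os_generator_in J : dependent H J -> ext_diff (ext_basis k J) \in I.
Proof.
move=> dJ; rewrite -[ext_diff _]mul1r -[_ * _]mulr1; apply: memv_mul; last exact: memvf.
apply: memv_mul; first exact: memvf.
by apply: memv_span; apply: map_f; rewrite mem_filter dJ mem_enum.
Qed.

Lemma ext_diff_gen3_in L p a b : L \in lines -> p \in L -> a \in L -> b \in L ->
  ext_diff (ext_gen k p * (ext_gen k a * ext_gen k b)) \in I.
Proof.
move=> Ll pL aL bL; have [c [-> c3]] := gen3_basis k p a b.
rewrite linearZ /=.
have [->|nc] := eqVneq c 0; first by rewrite scale0r mem0v.
apply/memvZ/os_generator_in/(line_dependent Ll); last exact: c3.
by apply/subsetP => i /setUP[/set2P[]->|/set1P->].
Qed.

(** The converse of [os_ideal_line_sum]: 2x splits into parts y, one per line. Zero line sums give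
    [ext_diff y = 0], so y is the differential of e_p y for any p on the line. *)
Lemma os_ideal2P x : pure_degree 2%N x ->
  (forall L a, L \in lines -> a \in L -> \sum_(b in L) coef2 x a b = 0) -> x \in I.
Proof.
move=> hx x0; have n2 := natr_neq0 char0 (isT : 0 < 2)%N.
rewrite -[x](scalerK n2) memvZ // pure_degree2_sum //.
(* Every pair of distinct indices lies on exactly one line, so the double sum splits over the
   lines. *)
pose F a b : E := coef2 x a b *: (ext_gen k a * ext_gen k b).
have -> : \sum_a \sum_b F a b = \sum_(L in lines) \sum_(a in L) \sum_(b in L) F a b.
  rewrite [RHS](exchange_big_dep xpredT) //=; apply: eq_bigr => a _.
  rewrite [RHS](exchange_big_dep xpredT) //=; apply: eq_bigr => b _.
  have [<-|ab] := eqVneq a b; first by rewrite /F coef2_diag // scale0r big1.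
  have [L [Ll aL bL]] := line_ex ab.
  rewrite (bigD1 L) ?Ll ?aL //= big1 ?addr0 // => L'.
  rewrite -!andbA => /and4P[L'l aL' bL' nL].
  by case/eqP: nL; apply: (line_inj L'l Ll ab).
apply: memv_suml => L Ll; have [->|[p pL]] := set_0Vmem L; first by rewrite big_set0 mem0v.
set y := \sum_(a in L) _.
have Dy : ext_diff y = 0.
  rewrite /y linear_sum; under eq_bigr do rewrite linear_sum /=.
  under eq_bigr => a _ do under eq_bigr => b _ do
    rewrite linearZ /= ext_diff_gen2 scalerBr.
  under eq_bigr do rewrite sumrB; rewrite sumrB exchange_big /= [X in X - _]big1 ?sub0r => [|b bL].
    rewrite big1 ?oppr0 // => a aL; by rewrite -scaler_suml x0 ?scale0r.
  rewrite -scaler_suml; under eq_bigr do rewrite coef2_anti.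
  by rewrite sumrN x0 // oppr0 scale0r.
have -> : y = ext_diff (ext_gen k p * y) by rewrite ext_diff_genM Dy mulr0 subr0.
rewrite /y mulr_sumr linear_sum; apply: memv_suml => a aL.
rewrite mulr_sumr linear_sum; apply: memv_suml => b bL.
by rewrite -scalerAr linearZ memvZ //; apply: (ext_diff_gen3_in Ll).
Qed.

End Ideal.
End Lines.

(** * Comparison with the given resolution *)

Section LinearStrandTor.
Variables (k K : fieldType) (l n : nat) (H : 'I_n -> {vspace 'rV[K]_l}).
Hypotheses (char0 : [pchar k] =i pred0) (arrH : central_arrangement H).
Variable F : graded_free_resolution (@os_homog k _ l n H).
Local Notation E := (exterior k n).
Local Notation I := (os_ideal k H).
Local Notation aug := (@ext_aug k n).

Definition res_complex : free_complex k n :=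
  FreeComplex (@res_diff_homog _ _ _ _ F) (@res_exactS _ _ _ _ F).
Local Notation C0 := res_complex.
Local Notation raug := (@res_aug _ _ _ _ F).

Lemma sub_tor_degree i j (v : 'rV_(res_rank F i)) :
  (v <= tor_degree F i j)%MS <-> @in_degree k n j C0 i v.
Proof.
split=> [/submxP[u ->] a /= ne|dv]; first by rewrite mul_mx_diag !mxE (negPf ne) mulr0.
apply/submxP; exists v; apply/rowP => a; rewrite mul_mx_diag !mxE.
by case: eqP => [_|/eqP/dv->]; rewrite ?mulr1 ?mul0r.
Qed.

Lemma sub_tor_cycles q j (v : 'rV_(res_rank F q.+1)) :
  (v <= tor_cycles F q.+1 j)%MS <->
  @in_degree k n j C0 q.+1 v /\ v *m red_diff C0 q = 0.
Proof.
rewrite /= sub_capmx; split=> [/andP[/sub_tor_degree dv /sub_kermxP]//|].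
by case=> /sub_tor_degree-> e; apply/sub_kermxP.
Qed.

Lemma sub_tor_boundaries q j (v : 'rV_(res_rank F q)) :
  (v <= tor_boundaries F q j)%MS <->
  exists2 w : 'rV_(res_rank F q.+1), @in_degree k n j C0 q.+1 w & v = w *m red_diff C0 q.
Proof.
split=> [/submxP[u ->]|[w /sub_tor_degree/submxP[u ->] ->]].
  exists (u *m tor_degree F q.+1 j); last by rewrite -mulmxA.
  by apply/sub_tor_degree; exact: submxMl.
by rewrite -mulmxA submxMl.
Qed.

(** Representatives of the images of the basis lift the augmentation to a one-column matrix over
    [E]; its kernel modulo the ideal is the image of the first differential. *)
Lemma ex_aug_lift : exists phi : 'M[E]_(res_rank F 0, 1),
  [/\ homog_mx (@res_deg _ _ _ _ F 0) (fun=> 0%N) phi,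
      forall v : 'rV_(res_rank F 0), (v *m phi) 0 0 \in I <-> exists w, v = w *m res_diff F 0
    & forall x, exists v : 'rV_(res_rank F 0), x - (v *m phi) 0 0 \in I].
Proof.
have ex a : exists x, ext_homog (res_deg F a) x /\ raug a = os_proj H x.
  by have [x hx ->] := @res_aug_homog _ _ _ _ F a; exists x.
have [f fP] := choice ex.
pose phi : 'M[E]_(res_rank F 0, 1) := \matrix_(a, _) f a; exists phi.
have augE (v : 'rV_(res_rank F 0)) : \sum_a v ord0 a *: raug a = os_proj H ((v *m phi) 0 0).
  rewrite mxE raddf_sum; apply: eq_bigr => a _ /=.
  by rewrite (fP a).2 mxE -os_scaleE.
have projP x : x \in I <-> os_proj H x = 0.
  by rewrite -{1}[x]subr0 -(os_projP _ x 0) raddf0.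
split=> [a b S|v|x].
- rewrite mxE addn0 => nz; have [/forallP/(_ S)] := fP a.
  by rewrite nz /= => /eqP->.
- by rewrite projP -augE (@res_exact0 _ _ _ _ F).
have [v e] := @res_aug_surj _ _ _ _ F (os_proj H x); exists v.
by apply/projP; rewrite raddfB /= -augE -e subrr.
Qed.


(** * Tor in the linear strand against the strands of the lines *)

Section Comparison.
Variable phi : 'M[E]_(res_rank F 0, 1).
Hypotheses (homog_phi : homog_mx (@res_deg _ _ _ _ F 0) (fun=> 0%N) phi)
  (ker_phi : forall v : 'rV_(res_rank F 0),
     (v *m phi) 0 0 \in I <-> exists w, v = w *m res_diff F 0)
  (onto_phi : forall x, exists v : 'rV_(res_rank F 0), x - (v *m phi) 0 0 \in I).
Variable q : nat.
Local Notation j := q.+2.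
Local Notation deg1 := (fun _ : 'I_1 => 0%N).
Local Notation grp := (@chain_group k n j C0).

(** A chain x in F_0 (x) Gamma_(q+1) links both sides: its zigzag ends at v, and the image of
    [koszul x] in I_2 (x) Gamma_q has the coefficients w. *)
Definition strand_rel (v : 'rV[k]_(res_rank F q.+1)) (w : 'I_n -> 'I_n -> seq 'I_n -> k) :=
  exists x, [/\ grp x, @zigzag k n j q.+1 C0 x v &
    forall a b s, size s = q -> w a b s = coef2 ((koszul x s *m phi) 0 0) a b].

Lemma strand_rel_linear c v v' w w' u : strand_rel v w -> strand_rel v' w' ->
  (forall a b s, u a b s = c * w a b s + w' a b s) -> strand_rel (c *: v + v') u.
Proof.
move=> [x [[sx hx] zx ex]] [x' [[sx' hx'] zx' ex']] eu.
exists (fun s => c%:A *: x s + x' s); split; last 1 first.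
- move=> a b s sq; rewrite eu ex // ex' // koszul_linear mulmxDl -scalemxAl !mxE.
  by rewrite -scalerAl mul1r coef2_linear.
- split; last exact: homog_linear.
  by move=> s t st; rewrite (sx _ _ st) (sx' _ _ st).
exact: zigzag_linear.
Qed.

Lemma zigzag_koszul_in x v : @zigzag k n j q.+1 C0 x v ->
  forall s, size s = q -> (koszul x s *m phi) 0 0 \in I.
Proof.
by case=> y [_ dx _] s sq; apply/ker_phi; exists (y s); rewrite dx.
Qed.

Lemma koszul_phi_pure x s : grp x -> size s = q -> pure_degree 2%N ((koszul x s *m phi) 0 0).
Proof.
case=> _ hx sq S ne; apply: (homog_mulmx homog_phi (homog_koszul hx)) => /=.
by rewrite sq addn0 -[q.+2]/(2 + q)%N eqn_add2r eq_sym.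
Qed.

Lemma koszul_row1 (x : seq 'I_n -> 'rV[E]_1) s :
  (koszul x s) 0 0 = \sum_d ext_gen k d * x (d :: s) 0 0.
Proof. exact: koszul_row. Qed.

Lemma strand_of_cycle v : (v <= tor_cycles F q.+1 j)%MS ->
  exists2 w, strand_rel v w & linear_strand (lines H) q w.
Proof.
move=> /sub_tor_cycles[dv cv].
have [x [[sx hx] zx]] := zigzag_right char0 dv cv.
have sk := symmetric_koszul sx.
exists (fun a b s => coef2 ((koszul x s *m phi) 0 0) a b).
  by exists x.
split=> [a b s t st|a b s|a b c s sq|L a s Ll aL sq].
- by rewrite (sk _ _ st).
- exact: coef2_anti.
- apply: oppr_inj; rewrite oppr0.
  rewrite -(contract3_koszul (fun t => (koszul x t *m phi) 0 0)).
  rewrite -(koszul_row1 (fun t => koszul x t *m phi)) -koszulM koszul_koszul //.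
  by rewrite mul0mx mxE !linear0 ext0.
exact: (os_ideal_line_sum arrH char0 (zigzag_koszul_in zx sq) Ll aL).
Qed.

(* Elements of [I] vanish in degree less than 2, where [phi] is therefore onto. *)
Lemma lift_phi p (u : seq 'I_n -> 'rV[E]_1) : (q < p)%N ->
    symmetric_fun u -> homog_fun j deg1 u ->
  exists y, grp y /\ forall s, size s = p -> u s = y s *m phi.
Proof.
move=> qp su hu.
have [s /eqP sp|y [sy hy ey]] := homog_lift (P := fun s => size s == p) homog_phi su hu.
  have [v vI] := onto_phi (u s 0 0).
  exists (homog_part j (@res_deg _ _ _ _ F 0) (size s) v).
  rewrite (homog_part_mulmx _ _ _ homog_phi).
  apply/rowP => i; rewrite (ord1 i) mxE; apply: exteriorP => S; rewrite ffunE.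
  case: ifPn => [/eqP e|ne]; last exact: hu.
  apply/eqP; rewrite -subr_eq0 -extN -extD; apply/eqP/(os_ideal_low arrH vI).
  by move: e qp; rewrite sp addn0 -[q.+2]/(2 + q)%N; lia.
by exists y; split=> // s sp; apply: ey; rewrite sp.
Qed.

Lemma phi_low_eq0 y s : grp y -> (q < size s)%N -> (y s *m phi) 0 0 \in I -> y s *m phi = 0.
Proof.
move=> [sy hy] qs yI; apply/rowP => i; rewrite (ord1 i) [RHS]mxE.
apply: exteriorP => S; rewrite ext0.
have [e|ne] := eqVneq j (#|S| + 0 + size s)%N; last exact: (homog_mulmx homog_phi hy).
by apply: (os_ideal_low arrH yI); move: e qs; rewrite -[q.+2]/(2 + q)%N; lia.
Qed.

(** The quadratic family u with coefficients w is a Koszul cycle by the cyclic identity and lies in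
    the ideal by the line sums. A Koszul preimage of u, lifted through [phi], starts a zigzag ending
    at v. *)
Lemma cycle_of_strand w : linear_strand (lines H) q w ->
  exists v, (v <= tor_cycles F q.+1 j)%MS /\ strand_rel v w.
Proof.
move=> sw; have n2 := natr_neq0 char0 (isT : 0 < 2)%N.
(* The sum runs over ordered pairs, so every product occurs twice; hence the factor 1/2. *)
pose u s : E := if size s == q then
  2%:R^-1 *: \sum_a \sum_b w a b s *: (ext_gen k a * ext_gen k b) else 0.
have su : symmetric_fun u.
  move=> s t st; rewrite /u (perm_size st); case: ifP => // _; congr (_ *: _).
  by do 2!apply: eq_bigr => ? _; rewrite (strand_sym sw _ _ st).
have hu s : pure_degree 2%N (u s).
  move=> S ne; rewrite /u; case: ifP => _; rewrite ?ext0 // extZ ext_sum big1 ?mulr0 // => a _.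
  by rewrite ext_sum big1 // => b _; rewrite extZ gen2_pure ?mulr0.
have cu a b s : size s = q -> coef2 (u s) a b = w a b s.
  move=> sq; rewrite /u sq eqxx.
  rewrite /coef2 !linearZ /= extZ !linear_sum ext_sum.
  rewrite (eq_bigr (fun c => \sum_d w c d s *
      ((a == c)%:R * (b == d)%:R - (a == d)%:R * (b == c)%:R))) => [|c _]; last first.
    rewrite !linear_sum ext_sum; apply: eq_bigr => d _.
    by rewrite !linearZ /= extZ -/(coef2 _ a b) coef2_gen2.
  under eq_bigr => c _ do (under eq_bigr do rewrite mulrBr; rewrite sumrB).
  rewrite sumrB (bigD1 a) //= (bigD1 b) //= !eqxx !mulr1.
  rewrite big1 ?addr0 => [|d db]; last by rewrite eq_sym (negPf db) !mulr0.
  rewrite big1 ?addr0 => [|c ca]; last first.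
    by rewrite big1 // => d _; rewrite eq_sym (negPf ca) mul0r mulr0.
  rewrite (bigD1 b) //= (bigD1 a) //= !eqxx !mulr1.
  rewrite big1 ?addr0 => [|d da]; last by rewrite eq_sym (negPf da) mul0r mulr0.
  rewrite big1 ?addr0 => [|c cb]; last first.
    by rewrite big1 // => d _; rewrite [b == c]eq_sym (negPf cb) !mulr0.
  rewrite (strand_alt sw b a) opprK -mulr2n -[w a b s *+ 2]mulr_natl mulKf //.
pose U s : 'rV[E]_1 := const_mx (u s).
have sU : symmetric_fun U by move=> s t st; rewrite /U (su s t st).
have hU : homog_fun j deg1 U.
  move=> s i S ne; rewrite mxE; have [sq|nsq] := eqVneq (size s) q.
    apply: hu; apply: contra ne => /eqP->; by rewrite sq.
  by rewrite /u (negPf nsq) ext0.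
have uI s : size s = q -> u s \in I.
  move=> sq; apply: (os_ideal2P arrH char0) => // L a Ll aL.
  by under eq_bigr do rewrite cu //; rewrite (strand_sum sw).
have [s sq||u' [su' hu' du']] := koszul_exact (q := q) char0 sU hU.
- apply/rowP => i; rewrite (ord1 i) koszul_row1 [RHS]mxE.
  under eq_bigr do rewrite mxE.
  apply: koszul2_eq0 => // a b c; rewrite !cu //; exact: (strand_cyc sw).
- by move=> _; apply/rowP => i; rewrite !mxE; apply: hu; rewrite cards0.
have [x [gx ex]] := lift_phi (ltnSn q) su' hu'.
have dx s : size s = q -> koszul x s *m phi = U s.
  move=> sq; rewrite -du' // koszulM; apply: eq_koszul => b.
  by rewrite ex //= sq.
have [s [sq]|v [zv dv cv]] := @zigzag_left k n char0 j q.+1 C0 x gx.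
  by apply/ker_phi; rewrite dx // mxE uI.
exists v; split; first exact/sub_tor_cycles.
by exists x; split=> // a b s sq; rewrite dx // mxE cu.
Qed.

(** As w = 0, x [phi] is a Koszul cycle, hence [koszul z]. Lifting z to y puts x - [koszul y] in the
    image of F_1 in Gamma-degree q + 1, so the zigzag of x ends in a boundary. *)
Lemma strand_rel_boundary v : strand_rel v (fun _ _ _ => 0) ->
  (v <= tor_boundaries F q.+1 j)%MS.
Proof.
move=> [x [gx zx cx]]; apply/sub_tor_boundaries.
have dx s : size s = q -> koszul x s *m phi = 0.
  move=> sq; apply/rowP => i; rewrite (ord1 i) [RHS]mxE.
  apply: (coef2_ext char0 (koszul_phi_pure gx sq)) => [S _|a b]; first exact: ext0.
  by rewrite -cx // /coef2 !linear0 ext0.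
have sxp : symmetric_fun (fun s => x s *m phi).
  by move=> s t st; rewrite (gx.1 _ _ st).
have hxp := homog_mulmx homog_phi gx.2.
have [s [sq]||z [sz hz dz]] := koszul_exact (q := q.+1) char0 sxp hxp.
- by rewrite -koszulM dx.
- by [].
have [y [gy ey]] := lift_phi (ltnW (ltnSn q.+1)) sz hz.
have gd := chain_groupB gx (chain_group_koszul gy).
have [s /eqP sq|y' [sy' hy' dy']] := homog_lift (P := fun s => size s == q.+1)
    (@fc_homog _ _ C0 0) gd.1 gd.2.
  apply/ker_phi; rewrite mulmxBl koszulM -dz //.
  rewrite [X in _ - X](_ : _ = koszul z s) ?subrr ?mxE ?mem0v //.
  by apply: eq_koszul => b; rewrite ey //= sq.
apply: (zigzag_bound char0 gx) zx; exists y', y; split=> // s sq.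
by rewrite -dy' ?sq // subrK.
Qed.

(** The part of x coming from F_1 is sent by [phi] into the ideal in degree at most 1, hence to 0;
    the Koszul part of x is killed by the second Koszul differential. *)
Lemma boundary_strand_rel v w : (v <= tor_boundaries F q.+1 j)%MS -> strand_rel v w ->
  forall a b s, size s = q -> w a b s = 0.
Proof.
move=> /sub_tor_boundaries[u du ->] [x [gx zx ex]] a b s sq; rewrite ex //.
have [y [z [gy gz xE]]] := bound_of_zigzag char0 du gx zx.
suff -> : koszul x s *m phi = 0 by rewrite mxE /coef2 !linear0 ext0.
have e c : x (c :: s) = y (c :: s) *m fc_diff C0 0 + koszul z (c :: s).
  by rewrite xE //= sq.
have -> : koszul x s = koszul (fun t => y t *m fc_diff C0 0) s + koszul (koszul z) s.
  by rewrite -big_split; apply: eq_bigr => c _; rewrite e scalerDr.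
rewrite koszul_koszul ?addr0 //; last by case: gz.
rewrite koszulM /koszul big1 // => c _.
rewrite (phi_low_eq0 (y := fun t => y t *m fc_diff C0 0)) ?scaler0 //=.
- exact: chain_groupM.
- by rewrite sq.
by apply/ker_phi; exists (y (c :: s)).
Qed.

Lemma strand_rel0 : strand_rel 0 (fun _ _ _ => 0).
Proof.
have [v [_ r0]] : exists v, (v <= tor_cycles F q.+1 j)%MS /\ strand_rel v (fun _ _ _ => 0).
  apply: cycle_of_strand; split=> // *; rewrite ?oppr0 ?addr0 //; exact: big1.
rewrite -(addNr v) -scaleN1r; apply: (strand_rel_linear r0 r0) => a b s.
by rewrite mulr0 addr0.
Qed.

Local Notation strand_of := (@strand_of k n (lines H) q).
Local Notation N := #|strand_index (lines H) q|.
Let rel (v : 'rV[k]_(res_rank F q.+1)) (c : 'rV[k]_N) := strand_rel v (strand_of c).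

Lemma eq_strand_rel v w w' : (forall a b s, size s = q -> w a b s = w' a b s) ->
  strand_rel v w -> strand_rel v w'.
Proof.
by move=> e [x [gx zx ex]]; exists x; split=> // a b s sq; rewrite -e // ex.
Qed.

Lemma strand_of0 a b s : strand_of 0 a b s = 0.
Proof.
have := strand_of_linear (-1) 0 0 a b s (Ls := lines H) (q := q) (k := k).
by rewrite scaler0 addr0 mulN1r addNr.
Qed.

Lemma rel0 : rel 0 0.
Proof. by apply: eq_strand_rel strand_rel0 => a b s _; rewrite strand_of0. Qed.

Lemma rel_linear c v v' w w' : rel v w -> rel v' w' -> rel (c *: v + v') (c *: w + w').
Proof.
move=> r r'; apply: strand_rel_linear r r' _ => a b s; exact: strand_of_linear.
Qed.

Let lex := line_ex arrH.
Let linj := line_inj arrH.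

Lemma linear_strand_lines c : linear_strand (lines H) q (strand_of c).
Proof. exact: linear_strand_of. Qed.

Lemma rel_ex w : exists v, (v <= tor_cycles F q.+1 j)%MS /\ rel v w.
Proof. by apply: cycle_of_strand; apply: linear_strand_lines. Qed.

Lemma rel_inj v w : (v <= tor_boundaries F q.+1 j)%MS -> rel v w -> w = 0.
Proof.
by move=> vB /(boundary_strand_rel vB); apply: strand_of_inj.
Qed.

Lemma betti_ge : (N <= betti F q.+1 q.+2)%N.
Proof.
exact: (rel_rank_ge rel0 (tor_boundaries_sub _ _ _) rel_linear rel_ex rel_inj).
Qed.

Lemma betti_le :
    (forall w : 'I_n -> 'I_n -> seq 'I_n -> k,
       linear_strand (lines H) q w -> supported (lines H) q w) ->
  (betti F q.+1 q.+2 <= N)%N.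
Proof.
move=> sup; apply: (rel_rank_le rel0 (tor_boundaries_sub _ _ _) rel_linear) => v vZ.
  have [w rw sw] := strand_of_cycle vZ.
  have [c cw] := strand_ofP char0 lex linj sw (sup w sw).
  by exists c; apply: eq_strand_rel rw.
move=> r0; apply: strand_rel_boundary; apply: eq_strand_rel r0 => a b s _.
exact: strand_of0.
Qed.

(** Equality of ranks makes every cycle homologous to one related to some [strand_of c]; the
    difference of the strands is then related to a boundary and vanishes. *)
Lemma supported_of_betti (w : 'I_n -> 'I_n -> seq 'I_n -> k) : betti F q.+1 q.+2 = N ->
  linear_strand (lines H) q w -> supported (lines H) q w.
Proof.
move=> eN sw; have [v [vZ rw]] := cycle_of_strand sw.
have [c [v' [rv' vB]]] := rel_rank_eq rel0 (tor_boundaries_sub _ _ _) rel_linear rel_ex rel_inj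
  (esym eN) vZ.
have wc a b s : size s = q -> w a b s = strand_of c a b s.
  move=> sq; apply/eqP; rewrite -subr_eq0; apply/eqP; move: a b s sq.
  apply: (boundary_strand_rel (w := fun a b s => w a b s - strand_of c a b s) vB).
  rewrite addrC -scaleN1r; apply: strand_rel_linear rv' rw _ => a b s.
  by rewrite mulN1r addrC.
move=> L a b d s Ll aL bL ab ds dL sq; rewrite wc //.
exact: (supported_strand_of linj c (p := q) Ll aL bL ab ds dL).
Qed.

End Comparison.

Lemma above_gt0 X : X \in rank2_flats H -> (0 < #|above H X|)%N.
Proof.
rewrite mem_filter mem_undup => /andP[/eqP cX /mapP[J _ eX]].
have [J0|[a aJ]] := set_0Vmem J.
  by move: cX; rewrite eX J0 /flat big_set0 /codim dim_fullv subnn.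
by apply/card_gt0P; exists a; rewrite inE eX flatS.
Qed.

(** A line is nonempty, so mu(X) = |L| - 1 is a natural number and the absolute value changes
    nothing. *)
Lemma mobius_binE i q : i = q.+1 ->
  (i * \sum_(X <- rank2_flats H) 'C(`|mobius H X| + i - 1, i + 1))%N =
  #|strand_index (lines H) q|.
Proof.
move=> ->; rewrite card_strand_index (sum_lines H (fun L => 'C(#|L|.-1 + q, q.+2))).
congr (_ * _)%N; apply: eq_big_seq => X X2.
rewrite rank2_mobius // -/(above H X) addn1 addnS subn1 /=.
by have := above_gt0 X2; case: #|_| => // m _; rewrite intS addrAC subrr add0r.
Qed.

End LinearStrandTor.

Local Close Scope ring_scope.

Theorem lemma2p8 (k : fieldType) (char0 : [pchar k]%R =i pred0)
    (R : realType) (l n : nat) (H : 'I_n -> {vspace 'rV[R[i]]_l})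
    (arrH : central_arrangement H)
    (F : graded_free_resolution (@os_homog k _ l n H)) :
  (forall i : nat, 1 <= i ->
     i * \sum_(X <- rank2_flats H) 'C(`|mobius H X| + i - 1, i + 1)
       <= betti F i (i + 1)) /\
  (betti F 2 3 = 2 * \sum_(X <- rank2_flats H) 'C(`|mobius H X| + 2 - 1, 3) ->
   forall i : nat, 2 <= i ->
     betti F i (i + 1) =
       i * \sum_(X <- rank2_flats H) 'C(`|mobius H X| + i - 1, i + 1)).
Proof.
have [phi [hphi kphi ophi]] := ex_aug_lift F.
split=> [[|q] // _|].
  by rewrite (mobius_binE arrH (erefl q.+1)) addn1 (betti_ge char0 arrH hphi kphi ophi).
rewrite (mobius_binE arrH (erefl 2)) => eq2 [|q] // q0.
rewrite (mobius_binE arrH (erefl q.+1)) addn1; apply/eqP; rewrite eqn_leq.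
rewrite (betti_ge char0 arrH hphi kphi ophi) andbT (betti_le char0 arrH hphi kphi ophi) //.
(* Equality for i = 2 says that strands of degree 1 are supported, and freezing entries extends this
   to all degrees. *)
move=> w; apply: (supported_all _ q0) => w1.
exact: (supported_of_betti char0 arrH hphi kphi ophi).
Qed.
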